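(* There exists an effective transformation $f:\mathbb{Q}\times\{0,1\}^\infty\times\{0,1\}^\infty\to\{0,1\}^\infty$ with the following property: if $\tau\in\mathbb{Q}\cap(0,1]$ and $x,y\in\{0,1\}^\infty$ are independent sequences that both have randomness rate $\tau$, then for every $\delta>0$ the sequence $f(\tau,x,y)$ has randomness rate $1-\delta$. Moreover, $f$ is a truth-table reduction.
   Context: Strings are finite binary strings, sequences are elements of $\{0,1\}^\infty$. For a string or sequence $x$, $x(n)$ is its $n$-th bit (indexing from 1) and $x(n_1:n_2)=x(n_1)x(n_1+1)\cdots x(n_2)$; juxtaposition $uv$ denotes concatenation. $K(u)$ is the plain Kolmogorov complexity of a string $u$ with respect to a fixed universal Turing machine $U$: $K(u)=\min\{|p|: U(p)=u\}$. A sequence $x$ has randomness rate $\sigma\in[0,1]$ if $K(x(1:n))\ge \sigma n$ for all but finitely many $n$. Two sequences $x,y$ are independent if there is a constant $c$ such that for all natural numbers $n,m\ge 1$, $K(x(1:n)y(1:m))\ge K(x(1:n))+K(y(1:m))-c(1+\log n+\log m)$. An effective transformation $f$ is given by a Turing machine $M_f$ with access to two oracles $x,y\in\{0,1\}^\infty$ (a query returns $x(n)$ or $y(n)$); on input $(\tau,1^n)$, $\tau$ a rational in canonical representation, it outputs one bit, and $f(\tau,x,y)=z$ means that for every $n$, $M_f$ on input $(\tau,1^n)$ with oracles $x,y$ halts and outputs $z(n)$. $f$ is a truth-table reduction if $M_f$ halts on all inputs with all oracles. *)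

(* Defs.v *)
From HB Require Import structures.
From mathcomp Require Import all_boot all_order all_algebra.
From mathcomp Require Import Rstruct.
From Stdlib Require Import Reals ClassicalEpsilon.
Set Implicit Arguments. Unset Strict Implicit. Unset Printing Implicit Defensive.
Import Order.TTheory GRing.Theory Num.Theory.

(* Functions act on argument lists of naturals.  [Proj i] returns the i-th
   argument (0 if absent), [Succ] the successor of the first argument,
   [OrX]/[OrY] query the oracle sequence x / y at the position given by the
   first argument and return the answer bit as 0/1. *)
Inductive code : Type :=
| Zero : code
| Succ : code
| Proj : nat -> code
| OrX : code
| OrY : code
| Comp : code -> list code -> code
| Prec : code -> code -> code
| Mu : code -> code.

Section Eval.
Variables (ox oy : nat -> bool).

Inductive eval : code -> list nat -> nat -> Prop :=
| eZero args : eval Zero args 0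
| eSucc args : eval Succ args (head 0 args).+1
| eProj i args : eval (Proj i) args (nth 0 args i)
| eOrX args : eval OrX args (nat_of_bool (ox (head 0 args)))
| eOrY args : eval OrY args (nat_of_bool (oy (head 0 args)))
| eComp f gs args vs r :
    evals gs args vs -> eval f vs r -> eval (Comp f gs) args r
| ePrec0 f g args r : eval f args r -> eval (Prec f g) (0 :: args) r
| ePrecS f g n args r r' :
    eval (Prec f g) (n :: args) r -> eval g [:: n, r & args] r' ->
    eval (Prec f g) (n.+1 :: args) r'
| eMu f args n :
    eval f (n :: args) 0 ->
    (forall m, m < n -> exists k, k <> 0 /\ eval f (m :: args) k) ->
    eval (Mu f) args n
with evals : list code -> list nat -> list nat -> Prop :=
| esNil args : evals [::] args [::]
| esCons g gs args v vs :
    eval g args v -> evals gs args vs -> evals (g :: gs) args (v :: vs).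
End Eval.

(* Bijective base-2 encoding of binary strings as naturals. *)
Definition nat_of_bits (s : seq bool) : nat :=
  foldl (fun acc (b : bool) => (2 * acc + 1 + b)%N) 0%N s.

(* Cantor pairing and zig-zag coding of integers. *)
Definition npair (a b : nat) : nat := ((a + b) * (a + b).+1 %/ 2 + b)%N.
Definition code_int (z : int) : nat :=
  match z with Posz n => (2 * n)%N | Negz n => (2 * n).+1 end.
Definition code_rat (q : rat) : nat :=
  npair (code_int (numq q)) (absz (denq q)).

Definition no_oracle : nat -> bool := fun _ => false.

Definition runs (M : code) (p u : seq bool) : Prop :=
  eval no_oracle no_oracle M [:: nat_of_bits p] (nat_of_bits u).

Definition universal (U : code) : Prop :=
  forall M : code, exists c : nat, forall p u, runs M p u ->
    exists q, runs U q u /\ (size q <= size p + c)%N.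

Definition Kc (U : code) (u : seq bool) : nat :=
  epsilon (inhabits 0%N)
    (fun k => (exists p, size p = k /\ runs U p u) /\
              (forall p, runs U p u -> (k <= size p)%N)).

(* A sequence is [nat -> bool]; position i (0-based) is the paper's bit
   x(i+1), so [prefix x n] is the paper's x(1:n). *)
Definition bitstream := nat -> bool.
Definition prefix (x : bitstream) (n : nat) : seq bool := mkseq x n.

Definition log2 (r : R) : R := ln r / ln 2.

Definition has_rate (U : code) (sigma : R) (x : bitstream) : Prop :=
  exists N : nat, forall n : nat, (N <= n)%N ->
    (sigma * INR n <= INR (Kc U (prefix x n)))%R.

Definition independent (U : code) (x y : bitstream) : Prop :=
  exists c : R, forall n m : nat, (1 <= n)%N -> (1 <= m)%N ->
    (INR (Kc U (prefix x n ++ prefix y m)) >=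
     INR (Kc U (prefix x n)) + INR (Kc U (prefix y m))
       - c * (1 + log2 (INR n) + log2 (INR m)))%R.

(* M_f on input (tau, 1^n) with oracles x, y: arguments [code tau; n];
   output bit b is represented by the natural nat_of_bool b.  Output index
   n is 0-based (the paper's z(n+1)). *)
Definition transforms (Mf : code) (tau : rat) (x y z : bitstream) : Prop :=
  forall n : nat, eval x y Mf [:: code_rat tau; n] (nat_of_bool (z n)).

Definition truth_table (Mf : code) : Prop :=
  forall (x y : bitstream) (tau : rat) (n : nat),
    exists v, eval x y Mf [:: code_rat tau; n] v.

(* Main.v *)
(** Cut [z] into blocks [z_j] of length about [3 j^2] and let [z_j] be the colour of
    [(x(1:t), y(1:t))], [t = t_(j+1)] growing geometrically, in a table found by
    exhaustive search in which no colour occurs much more often than average in any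
    rectangle with large enough sides (such tables exist by a union bound).
    If [K(z(1:n)) = k] is less than [(1 - delta) n], let [W_j] be the number of programs of
    length at most [k] whose output extends [z_0 ... z_(j-1)].  Since [W] drops from
    [2^(k+1)] to at least [1], some not too early block [j] has
    [W_(j+1) > W_j 2^(e_j - |z_j|)] with [e_j] a fixed fraction of [|z_j|].  Given the
    earlier prefixes, the colour [z_j] then lies in an enumerable set of relative density
    about [2^(-e_j)], so, among the pairs of strings with the complexities of [x(1:t)] and
    [y(1:t)], the pair [(x(1:t), y(1:t))] lies in an enumerable set of density about
    [2^(-e_j)].  Its index there gives
    [K(x(1:t) y(1:t)) <= K(x(1:t)) + K(y(1:t)) - e_j + O(log t)]; as [e_j] is quadratic in
    [j] and [log t] linear, this contradicts independence. *)

From HB Require Import structures.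
From mathcomp Require Import all_boot all_order all_algebra.
From mathcomp Require Import zify lra.
From Stdlib Require Import Classical ClassicalEpsilon.
Require Import Defs.
Set Implicit Arguments. Unset Strict Implicit. Unset Printing Implicit Defensive.

(** * Computable functions *)

(** The code must work under all oracles, so that it can serve both in programs, run with
    [no_oracle], and in the transformation. *)
Definition computable (k : nat) (f : seq nat -> nat) : Prop :=
  exists c : code, forall ox oy v, size v = k -> eval ox oy c v (f v).

Lemma comp_ext k f g : computable k f -> (forall v, size v = k -> g v = f v) -> computable k g.
Proof. by case=> c Hc fg; exists c => ox oy v sv; rewrite fg //; apply: Hc. Qed.

Lemma comp_nth k i : computable k (fun v => nth 0 v i).
Proof. by exists (Proj i) => *; constructor. Qed.

Lemma comp_head k : computable k (fun v => head 0 v).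
Proof. by apply: comp_ext (comp_nth k 0) _ => v _; rewrite nth0. Qed.

Lemma evals_map k (gs : seq (seq nat -> nat)) :
  (forall i, i < size gs -> computable k (nth (fun=> 0) gs i)) ->
  exists cs : seq code, forall ox oy v, size v = k ->
    evals ox oy cs v [seq g v | g <- gs].
Proof.
elim: gs => [|g gs IH] H; first by exists [::] => *; constructor.
have [cs Hcs] := IH (fun i => H i.+1).
by have [c Hc] := H 0 isT; exists (c :: cs) => ox oy v sv; constructor; auto.
Qed.

Lemma comp_app k n F (gs : seq (seq nat -> nat)) :
  computable n F -> size gs = n ->
  (forall i, i < size gs -> computable k (nth (fun=> 0) gs i)) ->
  computable k (fun v => F [seq g v | g <- gs]).
Proof.
case=> c Hc sgs /evals_map [cs Hcs].
exists (Comp c cs) => ox oy v sv; apply: eComp (Hcs _ _ _ sv) _.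
by apply: Hc; rewrite size_map.
Qed.

(** Closure under substitution lets [auto] assemble computability proofs along the syntax of a
    function; predicates count as 0/1-valued functions. *)
Local Notation comp1 F := (forall k f, computable k f -> computable k (fun v => F (f v))).
Local Notation comp2 F := (forall k f g, computable k f -> computable k g ->
  computable k (fun v => F (f v) (g v))).
Local Notation comp3 F := (forall k f g h, computable k f -> computable k g -> computable k h ->
  computable k (fun v => F (f v) (g v) (h v))).
Local Notation comp4 F := (forall k f g h f', computable k f -> computable k g -> computable k h ->
  computable k f' -> computable k (fun v => F (f v) (g v) (h v) (f' v))).
Local Notation comp5 F := (forall k f g h f' g',
  computable k f -> computable k g -> computable k h ->
  computable k f' -> computable k g' -> computable k (fun v => F (f v) (g v) (h v) (f' v) (g' v))).
Local Notation comp6 F := (forall k f g h f' g' h',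
  computable k f -> computable k g -> computable k h ->
  computable k f' -> computable k g' -> computable k h' ->
  computable k (fun v => F (f v) (g v) (h v) (f' v) (g' v) (h' v))).

Lemma comp1S : comp1 S.
Proof.
move=> k f Hf.
apply: (@comp_app k 1 (fun v => (head 0 v).+1) [:: f]) => // [|[|i] //].
by exists Succ => *; constructor.
Qed.

Lemma comp_const k n : computable k (fun=> n).
Proof.
elim: n => [|n IH]; last exact: comp1S.
by exists Zero => *; constructor.
Qed.

Lemma map_proj d k v : size v = d + k ->
  [seq g v | g <- mkseq (fun i (v : seq nat) => nth 0 v (d + i)) k] = drop d v.
Proof.
move=> sv; apply: (@eq_from_nth _ 0) => [|i].
  by rewrite size_map size_mkseq size_drop sv addKn.
rewrite size_map size_mkseq => ik.
by rewrite nth_drop (nth_map (fun=> 0)) ?size_mkseq ?nth_mkseq.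
Qed.

Lemma comp_subst k k' (F : seq nat -> nat) (d : nat) :
  computable k F -> k' = d + k -> computable k' (fun v => F (drop d v)).
Proof.
move=> HF ->.
apply: comp_ext (@comp_app (d + k) k F (mkseq (fun i v => nth 0 v (d + i)) k) HF _ _) _.
- by rewrite size_mkseq.
- by rewrite size_mkseq => i ik; rewrite nth_mkseq //; apply: comp_nth.
by move=> v sv; rewrite map_proj.
Qed.

Lemma comp_weak k f : computable k f -> computable k.+1 (fun v => f (behead v)).
Proof.
by move=> H; apply: comp_ext (@comp_subst k k.+1 f 1 H _) _ => // v _; rewrite drop1.
Qed.

Lemma comp_weak2 k f : computable k f -> computable k.+2 (fun v => f (behead (behead v))).
Proof. by move/comp_weak/comp_weak. Qed.

Lemma comp_weak3 k f : computable k f ->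
  computable k.+3 (fun v => f (behead (behead (behead v)))).
Proof. by move/comp_weak/comp_weak/comp_weak. Qed.

Lemma comp_skip k F : computable k.+1 F ->
  computable k.+2 (fun v => F (head 0 v :: behead (behead v))).
Proof.
move=> HF; pose fs := (fun v => head 0 v) :: mkseq (fun i (v : seq nat) => nth 0 v (2 + i)) k.
apply: comp_ext (@comp_app k.+2 k.+1 _ fs HF _ _) _.
- by rewrite /= size_mkseq.
- rewrite /= size_mkseq => -[|i] ik /=; first exact: comp_head.
  by rewrite nth_mkseq //; apply: comp_nth.
move=> v sv; rewrite [map _ _]/= map_proj ?sv //.
by case: v sv => [|a [|b v]] //= _; rewrite drop0.
Qed.

Lemma comp_nth_behead k i : computable k (fun v => nth 0 (behead v) i).
Proof. by apply: comp_ext (comp_nth k i.+1) _ => v _; rewrite nth_behead. Qed.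

Lemma comp_head_behead k : computable k (fun v => head 0 (behead v)).
Proof. by apply: comp_ext (comp_nth k 1) _ => v _; rewrite -nth0 nth_behead. Qed.

Lemma comp_head_behead2 k : computable k (fun v => head 0 (behead (behead v))).
Proof. by apply: comp_ext (comp_nth k 2) _ => v _; rewrite -nth0 !nth_behead. Qed.

Fixpoint prec (z : nat) (s : nat -> nat -> nat) (n : nat) : nat :=
  if n is n'.+1 then s n' (prec z s n') else z.

Lemma eq_prec z s s' n : (forall i a, i < n -> s i a = s' i a) ->
  prec z s n = prec z s' n.
Proof.
elim: n => //= n IH H; rewrite IH => [|i a lt]; first by rewrite H.
exact/H/ltnW.
Qed.

Lemma comp_prec k g z (s : seq nat -> nat -> nat -> nat) :
  computable k g -> computable k z ->
  computable k.+2 (fun v => s (behead (behead v)) (head 0 v) (head 0 (behead v))) ->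
  computable k (fun v => prec (z v) (s v) (g v)).
Proof.
move=> Hg [cz Hz] [cs Hs].
suff H : computable k.+1 (fun v => prec (z (behead v)) (s (behead v)) (head 0 v)).
  apply: comp_ext (@comp_app k k.+1 _ (g :: mkseq (fun i v => nth 0 v (0 + i)) k) H _ _) _.
  - by rewrite /= size_mkseq.
  - rewrite /= size_mkseq => -[|i] //= ik; rewrite nth_mkseq //; exact: comp_nth.
  by move=> v sv; rewrite [map _ _]/= map_proj ?drop0.
exists (Prec cz cs) => ox oy [|n v] //= [sv].
elim: n => [|n IH]; first by apply: ePrec0; apply: Hz.
by apply: ePrecS IH _; apply: (Hs ox oy [:: n, _ & v]); rewrite /= sv.
Qed.

Lemma comp2_prec (F : nat -> nat -> nat) (z : nat -> nat) (s : nat -> nat -> nat -> nat) :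
  (forall x y, F x y = prec (z y) (s y) x) ->
  comp1 z -> comp3 s -> comp2 F.
Proof.
move=> FE Hz Hs k f g Hf Hg.
apply: (@comp_ext k (fun v => prec (z (g v)) (s (g v)) (f v))); last by move=> v _.
apply: (@comp_prec k f (fun v => z (g v)) (fun v => s (g v))) => //; first exact: Hz.
by apply: Hs; [apply: comp_weak2|apply: comp_head|apply: comp_head_behead].
Qed.

Lemma comp2D : comp2 addn.
Proof.
refine (@comp2_prec addn id (fun y i a => a.+1) _ _ _).
- by move=> x y; elim: x => //= x <-.
- by move=> k f.
- by move=> k f g h _ _; apply: comp1S.
Qed.

Lemma comp2M : comp2 muln.
Proof.
refine (@comp2_prec muln (fun=> 0) (fun y i a => y + a) _ _ _).
- by move=> x y; elim: x => //= x <-; rewrite mulSn.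
- by move=> k f _; apply: comp_const.
- by move=> k f g h Hf _; apply: comp2D.
Qed.

Lemma comp2X : comp2 expn.
Proof.
have H : comp2 (fun x y => y ^ x).
  refine (@comp2_prec (fun x y => y ^ x) (fun=> 1) (fun y i a => y * a) _ _ _).
  - by move=> x y; elim: x => //= x <-; rewrite expnS.
  - by move=> k f _; apply: comp_const.
  - by move=> k f g h Hf _; apply: comp2M.
by move=> k f g Hf Hg; apply: H.
Qed.

Lemma comp1P : comp1 predn.
Proof.
have H : comp2 (fun x y => x.-1).
  refine (@comp2_prec (fun x y => x.-1) (fun=> 0) (fun y i a => i) _ _ _) => //.
  - by move=> x y; case: x.
  - by move=> k f _; apply: comp_const.
by move=> k f Hf; apply: (H k f f).
Qed.

Lemma comp2B : comp2 subn.
Proof.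
have H : comp2 (fun x y => y - x).
  refine (@comp2_prec (fun x y => y - x) id (fun y i a => a.-1) _ _ _) => //.
  - by move=> x y; elim: x => [|x IH] /=; [rewrite subn0|rewrite -IH subnS].
  - by move=> k f g h Hf _; apply: comp1P.
by move=> k f g Hf Hg; apply: H.
Qed.

Lemma comp1_eq0 : comp1 (fun x => x == 0).
Proof.
move=> k f Hf; apply: comp_ext (comp2B (comp_const k 1) Hf) _ => v _.
by case: (f v) => //= n; rewrite subSS sub0n.
Qed.

Lemma comp2_leq : comp2 leq.
Proof.
by move=> k f g Hf Hg; apply: comp_ext (comp1_eq0 (comp2B Hf Hg)) _ => v _.
Qed.

Lemma comp_and k (p q : seq nat -> bool) : computable k p -> computable k q ->
  computable k (fun v => p v && q v).
Proof.
move=> Hp Hq; apply: comp_ext (comp2M Hp Hq) _ => v _.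
by case: (p v); case: (q v).
Qed.

Lemma comp_not k (p : seq nat -> bool) : computable k p -> computable k (fun v => ~~ p v).
Proof. by move/comp1_eq0 => H; apply: comp_ext H _ => v _; case: (p v). Qed.

Lemma comp2_eq : comp2 (fun x y => x == y).
Proof.
move=> k f g Hf Hg.
apply: comp_ext (comp_and (comp2_leq Hf Hg) (comp2_leq Hg Hf)) _ => v _.
by rewrite eqn_leq.
Qed.

Definition bsum (n : nat) (F : nat -> nat) := \sum_(i < n) F i.

Lemma comp_bsum k g (F : seq nat -> nat -> nat) : computable k g ->
  computable k.+1 (fun v => F (behead v) (head 0 v)) ->
  computable k (fun v => bsum (g v) (F v)).
Proof.
move=> Hg HF.
apply: (@comp_ext k (fun v => prec 0 (fun i a => a + F v i) (g v))); last first.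
  rewrite /bsum => v _; elim: (g v) => [|n IH]; first by rewrite big_ord0.
  by rewrite big_ord_recr /= IH.
apply: (@comp_prec k g (fun=> 0) (fun v i a => a + F v i)) => //.
  exact: comp_const.
apply: comp2D; first exact: comp_head_behead.
exact: (comp_skip HF).
Qed.

Lemma bsum_count n (P : nat -> bool) : bsum n P = count P (iota 0 n).
Proof.
rewrite /bsum -(big_mkord xpredT (fun i => P i : nat)) /index_iota subn0.
by rewrite -big_mkcond /= sum1_count.
Qed.

Lemma bsumS n F : bsum n.+1 F = bsum n F + F n.
Proof. by rewrite /bsum big_ord_recr. Qed.

Lemma leq_bsum m n F : m <= n -> bsum m F <= bsum n F.
Proof.
move=> /subnK <-; elim: (n - m) => // d IH.
by rewrite addSn bsumS; apply: leq_trans IH (leq_addr _ _).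
Qed.

Lemma bsum_lt n q : q <= n -> bsum n (fun i => i < q) = q.
Proof.
move=> qn; rewrite /bsum -(big_mkord xpredT (fun i => (i < q) : nat)).
rewrite (big_cat_nat (n := q)) //=.
rewrite (eq_big_nat _ _ (F2 := fun=> 1)) => [|i /andP[_ ->]//].
rewrite sum_nat_const_nat muln1 subn0 big_nat big1 ?addn0 // => i /andP[qi _].
by rewrite ltnNge qi.
Qed.

Lemma eq_bsum n F G : (forall i, i < n -> F i = G i) -> bsum n F = bsum n G.
Proof. by move=> H; apply: eq_bigr => i _; apply: H. Qed.

Lemma divn_sum m d : m %/ d = bsum m (fun i => (0 < d) && (i.+1 * d <= m)).
Proof.
have [->|d0] := posnP d; first by rewrite divn0 /bsum big1.
by rewrite -[LHS](bsum_lt (leq_div m d)); apply: eq_bsum => i _; rewrite leq_divRL.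
Qed.

Lemma comp2_div : comp2 divn.
Proof.
move=> k f g Hf Hg.
apply: comp_ext; last by move=> v _; apply: divn_sum.
apply: (@comp_bsum k f (fun v i => (0 < g v) && (i.+1 * g v <= f v))) => //.
apply: comp_and; apply: comp2_leq.
- exact: comp_const.
- exact: comp_weak.
- by apply: comp2M; [apply/comp1S/comp_head|apply: comp_weak].
- exact: comp_weak.
Qed.

Lemma comp2_mod : comp2 modn.
Proof.
move=> k f g Hf Hg.
apply: comp_ext (comp2B Hf (comp2M (comp2_div Hf Hg) Hg)) _ => v _.
by rewrite {2}(divn_eq (f v) (g v)) addKn.
Qed.

Lemma comp1_odd : comp1 odd.
Proof.
move=> k f Hf; apply: comp_ext (comp2_mod Hf (comp_const k 2)) _ => v _.
by rewrite modn2.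
Qed.

Lemma comp1_logn2 : comp1 (logn 2).
Proof.
move=> k f Hf.
apply: (@comp_ext k (fun v => bsum (f v).-1 (fun i => f v %% 2 ^ i.+1 == 0))).
  apply: (@comp_bsum k (fun v => (f v).-1) (fun v i => f v %% 2 ^ i.+1 == 0)).
    exact: comp1P.
  apply/comp1_eq0/comp2_mod; first exact: comp_weak.
  by apply: comp2X; [apply: comp_const|apply/comp1S/comp_head].
by move=> v _; rewrite /bsum logn_count_dvd // big_add1 big_mkord.
Qed.


Create HintDb comp.
#[export] Hint Resolve comp_const comp_head comp_head_behead comp_head_behead2 comp_nth
  comp_nth_behead comp1S comp2D comp2M comp2X comp1P comp2B comp1_eq0 comp2_leq
  comp_and comp_not comp2_eq comp_bsum comp_prec comp2_div comp2_mod comp1_odd comp1_logn2 : comp.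
#[export] Hint Extern 2 (computable _ (fun v => _ (behead v))) => apply: comp_weak : comp.
#[export] Hint Extern 2 (computable _ (fun v => _ (behead (behead v)))) => apply: comp_weak2 : comp.
#[export] Hint Extern 2 (computable _ (fun v => _ (behead (behead (behead v))))) =>
  apply: comp_weak3 : comp.

#[export] Hint Extern 0 (computable _ _) => progress cbv beta : comp.

Lemma comp_or k (p q : seq nat -> bool) : computable k p -> computable k q ->
  computable k (fun v => p v || q v).
Proof.
move=> Hp Hq; apply: comp_ext (comp_not (comp_and (comp_not Hp) (comp_not Hq))) _.
by move=> v _; rewrite negb_and !negbK.
Qed.

Lemma comp_ltn k f g : computable k f -> computable k g -> computable k (fun v => f v < g v).
Proof. by auto with comp. Qed.

#[export] Hint Resolve comp_or comp_ltn : comp.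

(** The least [i < n] with [P i], or [n] if there is none: every index with no witness up to and
    including itself counts 1. *)
Definition bmin n (P : nat -> bool) := bsum n (fun i => bsum i.+1 P == 0).

Lemma comp_bmin k g (P : seq nat -> nat -> bool) : computable k g ->
  computable k.+1 (fun v => P (behead v) (head 0 v)) ->
  computable k (fun v => bmin (g v) (P v)).
Proof.
move=> Hg HP; rewrite /bmin; apply: comp_bsum => //.
apply: comp1_eq0; apply: comp_bsum; first by auto with comp.
exact: (comp_skip HP).
Qed.
#[export] Hint Resolve comp_bmin : comp.

Lemma bsumn_eq0 n F : (bsum n F == 0) = [forall i : 'I_n, F i == 0].
Proof. by rewrite /bsum sum_nat_eq0. Qed.

Lemma bsum_eq0 n (P : nat -> bool) : (bsum n P == 0) = [forall i : 'I_n, ~~ P i].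
Proof.
rewrite /bsum sum_nat_eq0; apply: eq_forallb => i; by case: (P i).
Qed.

Lemma bsum_gt0P n (P : nat -> bool) : reflect (exists2 i, i < n & P i) (0 < bsum n P).
Proof.
rewrite lt0n bsum_eq0 negb_forall; apply: (iffP existsP) => [[i]|[i lt Pi]].
  by rewrite negbK; exists (i : nat).
by exists (Ordinal lt); rewrite negbK.
Qed.

Lemma bmin_unique n (P : nat -> bool) m : m < n -> P m ->
  (forall l, l < m -> ~~ P l) -> bmin n P = m.
Proof.
move=> mn Pm min; rewrite -[RHS](@bsum_lt n) ?(ltnW mn) //; apply: eq_bsum => i _.
congr nat_of_bool; rewrite bsum_eq0; apply/forallP/idP => [H|im [l /= li]].
  by rewrite ltnNge; apply/negP => mi; have := H (Ordinal (mi : m < i.+1)); rewrite /= Pm.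
by apply: min; lia.
Qed.

Lemma bmin_exists n (P : nat -> bool) : (exists2 i, i < n & P i) -> bmin n P < n.
Proof.
case=> i0 lt0 P0; have ex : exists i, P i by exists i0.
case: (ex_minnP ex) => m Pm min; have mn : m < n by apply: leq_ltn_trans (min _ P0) lt0.
by rewrite (bmin_unique mn Pm) // => l lm; apply/negP => /min; lia.
Qed.

Lemma bminP n (P : nat -> bool) : bmin n P < n ->
  P (bmin n P) /\ (forall l, l < bmin n P -> ~~ P l).
Proof.
move=> lt; have [|/bsum_gt0P [i0 lt0 P0]] := posnP (bsum n P).
  move/eqP; rewrite bsum_eq0 => /forallP none; move: lt; rewrite {1}/bmin.
  rewrite (_ : bsum n _ = n) ?ltnn // -[RHS](@bsum_lt n n) //; apply: eq_bsum => i ltin.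
  rewrite ltin bsum_eq0; congr nat_of_bool; apply/forallP => -[l /= li].
  exact: (none (Ordinal (leq_trans li ltin))).
have ex : exists i, P i by exists i0.
case: (ex_minnP ex) => m Pm min; have mn : m < n by apply: leq_ltn_trans (min _ P0) lt0.
have nP l : l < m -> ~~ P l by move=> lm; apply/negP => /min; lia.
by rewrite (bmin_unique mn Pm).
Qed.

(** The digit of weight [M ^ c] of [T] in base [M]; finite functions are thereby coded as
    numbers. *)
Definition dig M T c := T %/ M ^ c %% M.
Lemma comp_dig : comp3 dig.
Proof. by rewrite /dig; auto 30 with comp. Qed.
#[export] Hint Resolve comp_dig : comp.

(** * Evaluation with bounded resources *)

Section CodeInd.
Variable P : code -> Prop.
Hypotheses (H0 : P Zero) (H1 : P Succ) (H2 : forall i, P (Proj i))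
  (H3 : P OrX) (H4 : P OrY)
  (H5 : forall f gs, P f -> (forall g, List.In g gs -> P g) -> P (Comp f gs))
  (H6 : forall f g, P f -> P g -> P (Prec f g)) (H7 : forall f, P f -> P (Mu f)).

(** The automatic induction principle has no hypothesis for the codes in the list of [Comp]. *)
Fixpoint code_ind_in (c : code) : P c :=
  match c with
  | Zero => H0 | Succ => H1 | Proj i => H2 i | OrX => H3 | OrY => H4
  | Comp f gs => H5 (code_ind_in f)
     ((fix loop (gs : list code) : forall g, List.In g gs -> P g :=
        match gs with
        | [::] => fun g (h : False) => match h with end
        | g0 :: gs' => fun g h =>
            match h with
            | or_introl e => eq_ind g0 P (code_ind_in g0) g e
            | or_intror h' => loop gs' g h'
            end
        end) gs)
  | Prec f g => H6 (code_ind_in f) (code_ind_in g)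
  | Mu f => H7 (code_ind_in f)
  end.
End CodeInd.

(* The value is [r.+1] if [c] is seen to halt with output [r] within fuel [s], and [0] if not;
   oracles answer [0], as [no_oracle] does. *)
Fixpoint ev (c : code) (s : nat) (v : seq nat) : nat :=
  match c with
  | Zero => 1
  | Succ => (head 0 v).+2
  | Proj i => (nth 0 v i).+1
  | OrX | OrY => 1
  | Comp f gs =>
      let ws := [seq ev g s v | g <- gs] in
      (0 < \prod_(w <- ws) w) * ev f s [seq w.-1 | w <- ws]
  | Prec f g =>
      (0 < size v) * prec (ev f s (behead v))
        (fun n r => (0 < r) * ev g s [:: n, r.-1 & behead v]) (head 0 v)
  | Mu f =>
      let n := bmin s (fun n => ev f s (n :: v) <= 1) in
      ((n < s) && (ev f s (n :: v) == 1)) * n.+1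
  end.

(** Only fuel and arguments vary, so induction on the fixed code [c] suffices and codes need no
    numbering. *)
Lemma comp_ev c k : computable k.+1 (fun v => ev c (head 0 v) (behead v)).
Proof.
elim/code_ind_in: c k => /= [||i|||f gs IHf IHg|f g IHf IHg|f IH] k.
- exact: comp_const.
- by auto with comp.
- by auto with comp.
- exact: comp_const.
- exact: comp_const.
- have Hg i : i < size gs ->
      computable k.+1 (fun v => nth 0 [seq ev g (head 0 v) (behead v) | g <- gs] i).
    elim: gs IHg i => [|g gs IH] IHg [|i] //= ig; first by apply: IHg; left.
    by apply: IH => // g' h; apply: IHg; right.
  apply: comp2M.
    apply: comp_ltn; first exact: comp_const.
    elim: gs Hg {IHg} => [|g gs IH] Hg /=.
      by apply: comp_ext (comp_const _ 1) _ => v _; rewrite big_nil.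
    apply: comp_ext (comp2M (Hg 0 isT) (IH (fun i => Hg i.+1))) _ => v _.
    by rewrite /= big_cons.
  pose fs := (fun v => head 0 v) :: mkseq (fun i (v : seq nat) =>
     (nth 0 [seq ev g (head 0 v) (behead v) | g <- gs] i).-1) (size gs).
  apply: comp_ext (@comp_app k.+1 (size gs).+1 _ fs (IHf _) _ _) _.
  + by rewrite /= size_mkseq.
  + rewrite /= size_mkseq => -[|i] ig; first exact: comp_head.
    by rewrite /= nth_mkseq //; apply: comp1P; apply: Hg.
  move=> v _ /=; congr ev; apply: (@eq_from_nth _ 0) => [|i].
    by rewrite !size_map size_iota.
  rewrite !size_map => ig.
  by rewrite (nth_map 0) ?size_map // (nth_map (fun=> 0)) ?size_mkseq // nth_mkseq.
- case: k => [|k].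
    apply: comp_ext (comp_const _ 0) _ => -[|s [|n v]] //.
  apply: comp2M.
    by apply: comp_ext (comp_const _ 1) _ => -[|s [|n v]].
  apply: (@comp_prec k.+2 _ (fun v => ev f (head 0 v) (behead (behead v)))
    (fun v n r => (0 < r) * ev g (head 0 v) [:: n, r.-1 & behead (behead v)])).
  + exact: comp_head_behead.
  + exact: (comp_skip (IHf k)).
  apply: comp2M; first by auto with comp.
  pose fs := [:: (fun v => nth 0 v 2), (fun v => nth 0 v 0), (fun v => (nth 0 v 1).-1) &
    mkseq (fun i (v : seq nat) => nth 0 v (4 + i)) k].
  apply: comp_ext (@comp_app k.+4 k.+3 _ fs (IHg k.+2) _ _) _.
  + by rewrite /= size_mkseq.
  + rewrite /= size_mkseq => -[|[|[|i]]] ig /=; try by auto with comp.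
    by rewrite /= nth_mkseq //; apply: comp_nth.
  move=> v sv; rewrite [map _ _]/= map_proj ?sv //.
  by case: v sv => [|a [|b [|c [|d v]]]] //= _; rewrite drop0.
- have H : computable k.+2 (fun v => ev f (head 0 (behead v)) (head 0 v :: behead (behead v))).
    pose fs := [:: (fun v => nth 0 v 1), (fun v => nth 0 v 0) &
      mkseq (fun i (v : seq nat) => nth 0 v (2 + i)) k].
    apply: comp_ext (@comp_app k.+2 k.+2 _ fs (IH k.+1) _ _) _.
    + by rewrite /= size_mkseq.
    + rewrite /= size_mkseq => -[|[|i]] ig /=; try by auto with comp.
      by rewrite /= nth_mkseq //; apply: comp_nth.
    move=> v sv; rewrite [map _ _]/= map_proj ?sv //.
    by case: v sv => [|a [|b v]] //= _; rewrite drop0.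
  have Hm : computable k.+1
      (fun v => bmin (head 0 v) (fun n => ev f (head 0 v) (n :: behead v) <= 1)).
    apply: (@comp_bmin k.+1 _ (fun v n => ev f (head 0 v) (n :: behead v) <= 1)) => //.
      exact: comp_head.
    by apply: comp2_leq => //; apply: comp_const.
  apply: comp2M; last exact: comp1S.
  apply: comp_and; first by apply: comp_ltn => //; apply: comp_head.
  apply: comp2_eq; last exact: comp_const.
  pose fs := (fun v => bmin (head 0 v) (fun n => ev f (head 0 v) (n :: behead v) <= 1)) ::
    mkseq (fun i (v : seq nat) => nth 0 v (0 + i)) k.+1.
  apply: comp_ext (@comp_app k.+1 k.+2 _ fs H _ _) _.
  + by rewrite /= size_map size_iota.
  + rewrite [size fs]/= size_map size_iota => -[|i] ig; first exact: Hm.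
    by rewrite /fs [nth _ _ _]/= nth_mkseq //; apply: comp_nth.
  by move=> v sv; rewrite /fs map_cons (@map_proj 0) ?drop0.
Qed.

(** For [Mu], the search stops at the first argument where [f] is not seen to return a positive
    value. Success thus means that all smaller arguments have positive values already, which more
    fuel preserves. *)
Lemma ev_mono c s s' v r : s <= s' -> ev c s v = r.+1 -> ev c s' v = r.+1.
Proof.
move=> le.
elim/code_ind_in: c v r => /= [||i|||f gs IHf IHg|f g IHf IHg|f IH] v r //.
- case: posnP => // pos; rewrite mul1n => /IHf Hf.
  suff -> : [seq ev g s' v | g <- gs] = [seq ev g s v | g <- gs] by rewrite pos mul1n.
  elim: gs IHg pos {Hf} => [|g gs IH] IHg //=; rewrite big_cons muln_gt0 => /andP[g0 gs0].
  rewrite (IHg g _ v (ev g s v).-1) ?prednK //; last by left.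
  by congr cons; apply: IH => // g' h; apply: IHg; right.
- case: v => [|n v] //=; rewrite !mul1n; elim: n r => [|n IHn] r /=; first exact: IHf.
  move: IHn; case: (prec _ _ n) => [|r'] //= /(_ _ erefl) ->; rewrite !mul1n.
  exact: IHg.
- set n := bmin s _; have [|] := boolP (n < s) => //= ns.
  have [_ min] := bminP ns.
  have [|] := boolP (_ == 1) => //= /eqP E; rewrite mul1n => -[<-].
  have E' := IH _ _ E.
  rewrite (@bmin_unique s' _ n) ?E' ?(leq_trans ns) ?mul1n // => l /min; rewrite -!ltnNge.
  by case El : (ev f s (l :: v)) => [|r'] // lt; rewrite (IH _ _ El).
Qed.

Lemma ev_complete c v r : eval no_oracle no_oracle c v r -> exists s, ev c s v = r.+1.
Proof.
elim/code_ind_in: c v r => /= [||i|||f gs IHf IHg|f g IHf IHg|f IH] v r H.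
- by exists 0; inversion H.
- by exists 0; inversion H.
- by exists 0; inversion H.
- by exists 0; inversion H.
- by exists 0; inversion H.
- inversion H as [| | | | |? ? ? vs ? Hgs Hf| | |]; subst.
  have [s1 E1] := IHf _ _ Hf.
  have [s2 E2] : exists s, [seq ev g s v | g <- gs] = [seq w.+1 | w <- vs].
    elim: gs IHg vs Hgs {Hf E1 H} => [|g gs IH] IHg vs Hgs.
      by inversion Hgs; exists 0.
    inversion Hgs as [|? ? ? w ws Hw Hws]; subst.
    have [|s2 E2] := IH _ _ Hws; first by move=> g' h; apply: IHg; right.
    have [s3 E3] := IHg g (or_introl erefl) _ _ Hw.
    exists (maxn s2 s3); rewrite /= (ev_mono (leq_maxr _ _) E3); congr cons.
    elim: (gs) (ws) E2 => [|g' gs' IH'] [|w' ws'] //= [E4 E5].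
    by rewrite (ev_mono (leq_maxl _ _) E4) (IH' ws').
  have E3 : [seq ev g (maxn s1 s2) v | g <- gs] = [seq w.+1 | w <- vs].
    elim: (gs) (vs) E2 => [|g' gs' IH'] [|w' ws'] //= [E4 E5].
    by rewrite (ev_mono (leq_maxr _ _) E4) (IH' ws').
  exists (maxn s1 s2); rewrite E3 -map_comp map_id (ev_mono (leq_maxl _ _) E1).
  rewrite (_ : 0 < _) ?mul1n // big_map.
  by elim: (vs) => [|w ws IHw]; rewrite ?big_nil // big_cons muln_gt0.
- have {H} [n [v' [-> H]]] : exists n v',
      v = n :: v' /\ eval no_oracle no_oracle (Prec f g) (n :: v') r.
    by inversion H; subst; [exists 0; exists args|exists n.+1; exists args].
  rewrite /=; elim: n r H => [|n IHn] r H;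
    inversion H as [| | | | | |? ? ? ? Hf|? ? ? ? r' ? Hp Hg|]; subst.
    by have [s E] := IHf _ _ Hf; exists s; rewrite mul1n.
  have [s1 E1] := IHn _ Hp; have [s2 E2] := IHg _ _ Hg.
  exists (maxn s1 s2).
  have := @ev_mono (Prec f g) s1 (maxn s1 s2) (n :: v') r' (leq_maxl _ _) E1.
  by rewrite /= !mul1n => ->; rewrite mul1n /= (ev_mono (leq_maxr _ _) E2).
- inversion H as [| | | | | | | |? ? ? Hr Hl]; subst.
  have [s1 E1] := IH _ _ Hr.
  have [s2 E2] : exists s, forall l, l < r -> 1 < ev f s (l :: v).
    elim: r Hl {H Hr E1} => [|r IHr] Hl; first by exists 0.
    have [|s2 E2] := IHr; first by move=> l lr; apply: Hl; lia.
    have [[|k] [k0 /IH [s3 E3]]] // := Hl r (ltnSn r).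
    exists (maxn s2 s3) => l; rewrite ltnS leq_eqVlt => /orP[/eqP->|/E2].
      by rewrite (ev_mono (leq_maxr _ _) E3).
    by case E : (ev _ _ _) => [|r'] // h; rewrite (ev_mono (leq_maxl _ _) E).
  (* The fuel also bounds the search range, so it has to exceed [r]. *)
  pose s := maxn r.+1 (maxn s1 s2).
  have E1' : ev f s (r :: v) = 1 by apply: ev_mono E1; rewrite /s; lia.
  have rs : r < s by rewrite /s; lia.
  exists s; rewrite (@bmin_unique s _ r) ?E1' ?rs ?mul1n // => l /E2.
  case E : (ev _ _ _) => [|r'] // h; rewrite (@ev_mono _ s2 s _ _ _ E) -?ltnNge //.
  by rewrite /s; lia.
Qed.

(** * Kolmogorov complexity *)

(* The number with binary expansion [1s]: prefixes become quotients by powers of 2. *)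
Definition beta (s : seq bool) : nat := (nat_of_bits s).+1.

Lemma beta_rcons s b : beta (rcons s b) = (beta s).*2 + b.
Proof. by rewrite /beta /nat_of_bits foldl_rcons; lia. Qed.

Lemma beta_cat s s' : beta (s ++ s') + 2 ^ size s' = beta s * 2 ^ size s' + beta s'.
Proof.
elim/last_ind: s' => [|s' b IH]; first by rewrite cats0 /= muln1.
rewrite -rcons_cat !beta_rcons size_rcons expnS; lia.
Qed.

Lemma beta_bounds s : 2 ^ size s <= beta s < 2 ^ (size s).+1.
Proof.
elim/last_ind: s => [|s b]; first by [].
by rewrite beta_rcons size_rcons !expnS; lia.
Qed.

Lemma beta_surj w : 0 < w -> exists s, beta s = w.
Proof.
elim/ltn_ind: w => -[|[|w]] // IH _; first by exists [::].
have [||s Es] := IH (w.+2)./2; [lia|lia|].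
by exists (rcons s (odd w.+2)); rewrite beta_rcons Es; lia.
Qed.

(** Together with [logn 2], this inverts the pairing [2 ^ l * (2 * r + 1)]: it returns [r]. *)
Definition oddhalf n := n %/ 2 ^ logn 2 n %/ 2.

Lemma comp_oddhalf : comp1 oddhalf.
Proof. by rewrite /oddhalf; auto 20 with comp. Qed.
#[export] Hint Resolve comp_oddhalf : comp.

Lemma logn2_pair l r : logn 2 (2 ^ l * r.*2.+1) = l.
Proof.
rewrite lognM ?expn_gt0 // lognX logn_prime // muln1 lognE /=.
by rewrite dvdn2 /= odd_double /= addn0.
Qed.

Lemma oddhalf_pair l r : oddhalf (2 ^ l * r.*2.+1) = r.
Proof. by rewrite /oddhalf logn2_pair mulKn ?expn_gt0 //; lia. Qed.

Section Kolmogorov.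
Variables (U : code) (HU : universal U).

Lemma runs_exists u : exists p, runs U p u.
Proof.
have [c Hc] := HU (Proj 0); have [|q [Hq _]] := Hc u u; last by exists q.
exact: (eProj _ _ 0 [:: nat_of_bits u]).
Qed.

(** By universality some program prints [u], so a shortest one exists and the [epsilon] in [Kc]
    picks its length. *)
Lemma Kc_spec u : (exists p, size p = Kc U u /\ runs U p u) /\
  (forall p, runs U p u -> Kc U u <= size p).
Proof.
rewrite /Kc; apply epsilon_spec.
have [p] := runs_exists u; have [n] := ubnP (size p); elim: n p => // n IH p pn Hp.
case: (classic (exists2 p', runs U p' u & size p' < size p)) => [[p' Hp' lt]|none].
  by apply: (IH p') => //; lia.
exists (size p); split=> [|p' Hp']; first by exists p.
by rewrite leqNgt; apply/negP => lt; apply: none; exists p'.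
Qed.

Lemma Kc_le M : exists c, forall p u, runs M p u -> Kc U u <= size p + c.
Proof.
have [c Hc] := HU M; exists c => p u /Hc [q [Hq sq]].
by apply: leq_trans sq; have [_] := Kc_spec u; apply.
Qed.

Lemma Kc_le_size : exists c, forall u, Kc U u <= size u + c.
Proof.
have [c Hc] := Kc_le (Proj 0); exists c => u; apply: Hc.
exact: (eProj _ _ 0 [:: nat_of_bits u]).
Qed.

Section Enumeration.
Variables (g : nat) (D : nat -> nat -> nat -> bool) (o : nat -> nat -> nat -> nat).
Hypotheses (HD : comp3 D) (Ho : comp3 o).

(** Only the first stage that lists a value is new, so [rank] numbers the values without
    repetition. *)
Let new l q n := D l q n && (bsum n (fun n' => D l q n' && (o l q n' == o l q n)) == 0).
Let rank l q n := bsum n (new l q).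

Let comp_new : comp3 new.
Proof. rewrite /new; auto 30 using HD, Ho with comp. Qed.

Let comp_rank : comp3 rank.
Proof. rewrite /rank; auto 30 using comp_new with comp. Qed.

Let param w := oddhalf w %% 2 ^ (g * logn 2 w).
Let position w := oddhalf w %/ 2 ^ (g * logn 2 w).

Let comp_param : comp1 param.
Proof. by rewrite /param; auto 20 with comp. Qed.

Let comp_position : comp1 position.
Proof. by rewrite /position; auto 20 with comp. Qed.

(* An element of an enumerable set with at most [2 ^ B] elements, given parameters [l] and [q],
   is described by its rank in the enumeration; the program [2 ^ l * (2 * r + 1)] is
   self-delimiting in [l], and [r] has [q] as its [g * l] low-order bits. *)
Lemma Kc_enum : exists c, forall l q n B u, q < 2 ^ (g * l) -> D l q n ->
  o l q n = nat_of_bits u ->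
  (forall r : seq nat, uniq r ->
     (forall w, w \in r -> exists n', D l q n' /\ o l q n' = w) -> size r <= 2 ^ B) ->
  Kc U u <= B + g.+1 * l + c.
Proof.
have [ct Hct] : computable 2 (fun v =>
    ~~ (new (logn 2 (nth 0 v 1)) (param (nth 0 v 1)) (nth 0 v 0) &&
    (rank (logn 2 (nth 0 v 1)) (param (nth 0 v 1)) (nth 0 v 0) == position (nth 0 v 1)))).
  by auto 20 using comp_param, comp_position, comp_new, comp_rank with comp.
have [co Hco] : computable 2 (fun v => o (logn 2 (nth 0 v 1)) (param (nth 0 v 1)) (nth 0 v 0)).
  by auto 20 using comp_param, Ho with comp.
(* The decoder searches for the new stage whose rank is stored in the program, and outputs its
   value. *)
have [c Hc] := Kc_le (Comp co [:: Mu ct; Proj 0]).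
exists c.+1 => l q n B u qB Dn on small.
have [n0 [new0 o0]] : exists n0, new l q n0 /\ o l q n0 = nat_of_bits u.
  elim/ltn_ind: n Dn on => n IH Dn on.
  case: (posnP (bsum n (fun n' => D l q n' && (o l q n' == o l q n)))) => [e0|].
    by exists n; rewrite /new Dn e0.
  by case/bsum_gt0P => i lt /andP[Di /eqP Ei]; apply: (IH i) => //; rewrite Ei.
have iB : rank l q n0 < 2 ^ B.
  pose r := [seq o l q n' | n' <- iota 0 n0.+1 & new l q n'].
  have -> : (rank l q n0).+1 = size r.
    by rewrite size_map size_filter -bsum_count bsumS new0 addn1.
  apply: small => [|w /mapP [n' ]]; last first.
    by rewrite mem_filter => /andP[/andP[Dn' _] _] ->; exists n'.
  rewrite map_inj_in_uniq ?filter_uniq ?iota_uniq // => i j.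
  wlog : i j / i < j => [wl Hi Hj E|ij].
    case: (ltngtP i j) => // lt; first exact: wl.
    by apply/esym/wl.
  rewrite !mem_filter => /andP[/andP[Di _] _] /andP[/andP[_]].
  rewrite bsum_eq0 => /forallP /(_ (Ordinal ij)) /=; rewrite Di /= => ne _ E.
  by rewrite E eqxx in ne.
pose idx := rank l q n0; pose r := idx * 2 ^ (g * l) + q; pose w := 2 ^ l * r.*2.+1.
have w0 : 0 < w by rewrite muln_gt0 expn_gt0.
have [p Ep] := @beta_surj w.+1 isT; case: Ep => Ep.
have lwE : logn 2 w = l by apply: logn2_pair.
have qwE : param w = q by rewrite /param lwE oddhalf_pair modnMDl modn_small.
have iwE : position w = idx.
  by rewrite /position lwE oddhalf_pair divnMDl ?expn_gt0 // divn_small ?addn0.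
have sp : size p <= B + g.+1 * l + 1.
  rewrite -ltnS -(@ltn_exp2l 2) //; have /andP[lo _] := beta_bounds p.
  apply: leq_ltn_trans lo _; rewrite /beta Ep.
  have : r.+1 <= 2 ^ B * 2 ^ (g * l).
    apply: leq_trans (_ : idx.+1 * 2 ^ (g * l) <= _); first by rewrite mulSn /r; lia.
    by rewrite leq_mul2r iB orbT.
  move=> h; rewrite (_ : 2 ^ _ = 2 ^ l * (2 ^ B * 2 ^ (g * l) * 2 ^ 2)); last first.
    rewrite -!expnD; congr (2 ^ _); lia.
  apply: (@leq_ltn_trans (2 ^ l * r.*2.+2)); last by rewrite ltn_mul2l expn_gt0 /=; lia.
  have : 0 < 2 ^ l by rewrite expn_gt0.
  by rewrite /w; nia.
apply: leq_trans (_ : size p + c <= _); last by lia.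
apply: Hc; rewrite /runs Ep.
apply: (@eComp _ _ _ _ _ [:: n0; w]); last first.
  by rewrite -o0; have := Hco no_oracle no_oracle [:: n0; w] erefl; rewrite /= lwE qwE.
constructor; last by constructor; [apply: (eProj _ _ 0 [:: w])|constructor].
apply: eMu => [|m mn].
  have := Hct no_oracle no_oracle [:: n0; w] erefl.
  by rewrite /= lwE qwE iwE new0 eqxx.
exists 1; split=> //; have := Hct no_oracle no_oracle [:: m; w] erefl.
rewrite /= lwE qwE iwE; case: (boolP (new l q m)) => //= newm.
(* A new stage before [n0] has a smaller rank, so the search does not stop there. *)
suff -> : rank l q m == idx = false by [].
apply/negbTE; rewrite neq_ltn; apply/orP; left.
by apply: leq_trans (leq_bsum _ mn); rewrite bsumS newm addn1.
Qed.
End Enumeration.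
End Kolmogorov.

(** * Existence of two-source extractors *)

(** A set of at most [K] elements is listed by a function from ['I_K] to [option T], with [None] as
    padding. *)
Lemma card_small_sets (T : finType) K :
  #|[set B : {set T} | #|B| <= K]| <= #|T|.+1 ^ K.
Proof.
rewrite -card_option -[X in _ ^ X]card_ord -card_ffun.
pose F (f : {ffun 'I_K -> option T}) := [set x | Some x \in codom f].
apply: leq_trans (leq_imset_card F _); apply/subset_leq_card/subsetP => B.
rewrite inE => sB; apply/imsetP.
exists [ffun i : 'I_K => nth None [seq Some x | x <- enum B] i] => //.
apply/setP => x; rewrite inE; apply/idP/codomP => [xB|[i]].
  have xi : index x (enum B) < #|B| by rewrite cardE index_mem mem_enum.
  exists (Ordinal (leq_trans xi sB)); rewrite ffunE /= (nth_map x); last by rewrite -cardE.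
  by rewrite nth_index ?mem_enum.
rewrite ffunE => E.
have : Some x \in [seq Some x | x <- enum B].
  rewrite E mem_nth //; apply: contra_eqT E; rewrite -leqNgt => le.
  by rewrite nth_default.
by rewrite mem_map ?mem_enum // => ? ? [].
Qed.

Lemma fact_lower n k : n`! * n ^ k <= (n + k)`!.
Proof.
elim: k => [|k IH]; first by rewrite addn0 muln1.
by rewrite addnS factS expnS mulnCA leq_mul // -addnS leq_addr.
Qed.

(** A weak Stirling bound, [n! >= (n / 4) ^ n] for powers of two, by doubling:
    [(2n)! >= n! * n ^ n]. *)
Lemma pow2_le_fact r : (2 ^ r) ^ (2 ^ r) <= 4 ^ (2 ^ r) * (2 ^ r)`!.
Proof.
elim: r => // r IH; set n := 2 ^ r in IH *.
rewrite expnS mul2n -addnn -/n.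
have -> : (n + n) ^ (n + n) = 4 ^ n * (n ^ n * n ^ n).
  have -> : 4 = 2 * 2 by [].
  by rewrite {1}addnn -mul2n (expnMn 2) !expnD (expnMn 2 2).
rewrite expnD -!mulnA leq_mul2l; apply/orP; right.
apply: leq_trans (leq_mul IH (leqnn _)) _.
by rewrite -mulnA leq_mul2l fact_lower orbT.
Qed.

Lemma sum_indicator (T : finType) (P : pred T) : \sum_i nat_of_bool (P i) = #|[set i | P i]|.
Proof. by rewrite -big_mkcond sum1_card cardsE. Qed.

Section Extractor.
Variables N M K R : nat.
Let cell : finType := ('I_N * 'I_N)%type.
Let table : finType := {ffun cell -> 'I_M}.

Lemma card_const_on (C : {set cell}) (a : 'I_M) :
  #|[set E : table | [forall p in C, E p == a]]| = M ^ (N * N - #|C|).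
Proof.
have -> : #|[set E : table | [forall p in C, E p == a]]| =
    #|family (fun p : cell => if p \in C then pred1 a else predT)|.
  apply: eq_card => E; rewrite inE; apply/forall_inP/familyP => H p.
    by case: ifP => // /H.
  by move=> pC; have := H p; rewrite pC.
rewrite card_family foldrE big_map big_enum /=.
rewrite (eq_bigr (fun p : cell => if p \in ~: C then M else 1)) => [|p _].
  rewrite -big_mkcond /= prod_nat_const cardsCs setCK; congr (M ^ (_ - _)).
  by rewrite card_prod card_ord.
by rewrite inE; case: ifP => _; rewrite ?card1 ?card_ord.
Qed.

Hypothesis counts : N.+1 ^ K * (N.+1 ^ K * ('C(K * K, R) * M)) < M ^ R.

(** A union bound: a table that fails has [R] cells of one colour in some small rectangle, and by
    [counts] the tables with a given such configuration, added up over all configurations, are fewer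
    than all tables. *)
Lemma extractor_exists : 0 < M -> exists E : table,
  forall (B1 B2 : {set 'I_N}) (a : 'I_M),
  #|B1| <= K -> #|B2| <= K -> #|[set p in setX B1 B2 | E p == a]| <= R.
Proof.
move=> M0; case: (leqP R (N * N)) => [RN|NR]; last first.
  exists [ffun=> Ordinal M0] => B1 B2 a _ _; apply: leq_trans (max_card _) _.
  by rewrite card_prod card_ord ltnW.
have [/existsP [E /forallP H]|] := boolP [exists E : table, [forall B1 : {set 'I_N},
   [forall B2 : {set 'I_N}, [forall a, (#|B1| <= K) ==> (#|B2| <= K) ==>
     (#|[set p in setX B1 B2 | E p == a]| <= R)]]]].
  exists E => B1 B2 a s1 s2; have /forallP /(_ B2) /forallP /(_ a) := H B1.
  by rewrite s1 s2.
rewrite negb_exists => /forallP H; exfalso.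
(* [S] counts tables together with a rectangle, a colour and [R] cells of that colour in it. If all
   tables fail, each is counted at least once. *)
pose S := \sum_(B1 : {set 'I_N} | #|B1| <= K) \sum_(B2 : {set 'I_N} | #|B2| <= K)
  \sum_(C : {set cell} | (C \subset setX B1 B2) && (#|C| == R)) \sum_(a : 'I_M)
    \sum_(E : table) nat_of_bool [forall p in C, E p == a].
have lo : M ^ (N * N) <= S.
  rewrite (_ : M ^ (N * N) = \sum_(E : table) 1); last first.
    by rewrite sum1_card card_ffun card_prod !card_ord.
  have -> : S = \sum_(E : table)
      \sum_(B1 : {set 'I_N} | #|B1| <= K) \sum_(B2 : {set 'I_N} | #|B2| <= K)
      \sum_(C : {set cell} | (C \subset setX B1 B2) && (#|C| == R)) \sum_(a : 'I_M)
        nat_of_bool [forall p in C, E p == a].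
    rewrite [RHS]exchange_big; apply: eq_bigr => B1 _.
    rewrite [RHS]exchange_big; apply: eq_bigr => B2 _.
    rewrite [RHS]exchange_big; apply: eq_bigr => C _.
    by rewrite [RHS]exchange_big.
  apply: leq_sum => E _.
  have := H E; rewrite negb_forall => /existsP [B1].
  rewrite negb_forall => /existsP [B2]; rewrite negb_forall => /existsP [a].
  rewrite !negb_imply -ltnNge => /and3P[s1 s2 big].
  have [C sC cC] : exists2 C : {set cell}, C \subset [set p in setX B1 B2 | E p == a] & #|C| = R.
    set A := [set _ in _ | _] in big *.
    have : 0 < #|[set C : {set cell} | C \subset A & #|C| == R]|.
      by rewrite cards_draws bin_gt0 ltnW.
    by case/card_gt0P => C; rewrite inE => /andP[? /eqP]; exists C.
  have sub : C \subset setX B1 B2.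
    by apply: subset_trans sC _; apply/subsetP => p; rewrite inE => /andP[].
  rewrite (bigD1 B1) //= (bigD1 B2) //= (bigD1 C) /= ?sub ?cC ?eqxx // (bigD1 a) //=.
  rewrite (_ : [forall p in C, E p == a] = true) ?addSn //.
  by apply/forall_inP => p /(subsetP sC); rewrite inE => /andP[].
have up : S <= N.+1 ^ K * (N.+1 ^ K * ('C(K * K, R) * (M * M ^ (N * N - R)))).
  have sets : \sum_(B : {set 'I_N} | #|B| <= K) 1 <= N.+1 ^ K.
    rewrite sum1_card -[X in X.+1](card_ord N); apply: leq_trans (card_small_sets _ _).
    by rewrite cardsE.
  apply: leq_trans (leq_mul sets (leqnn _)); rewrite big_distrl /=.
  apply: leq_sum => B1 s1; rewrite mul1n.
  apply: leq_trans (leq_mul sets (leqnn _)); rewrite big_distrl /=.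
  apply: leq_sum => B2 s2; rewrite mul1n.
  have le : #|setX B1 B2| <= K * K by rewrite cardsX leq_mul.
  apply: leq_trans (leq_mul (leq_bin2l _ le) (leqnn _)).
  rewrite -cards_draws -sum1_card big_distrl /=.
  rewrite (eq_bigl (mem [set A' : {set cell} | A' \subset setX B1 B2 & #|A'| == R]))
    => [|C]; last first.
    by rewrite !inE.
  apply: leq_sum => C; rewrite !inE => /andP[_ /eqP cC]; rewrite mul1n.
  rewrite -[X in X * _](card_ord M) -sum1_card big_distrl /=.
  by apply: leq_sum => a _; rewrite mul1n sum_indicator card_const_on cC.
have := leq_trans lo up; rewrite leqNgt => /negP; apply.
rewrite -[X in _ < M ^ X](subnKC RN) expnD !mulnA ltn_mul2r expn_gt0 M0 /=.
by rewrite -!mulnA.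
Qed.
End Extractor.

(* A table is the number whose digits in base [M] are its colours, a subset of [0 .. N - 1]
   the number whose bits are its indicator. *)
Definition bit B X := odd (B %/ 2 ^ X).
Definition card_mask N B := bsum N (bit B).
Definition cells N M T B1 B2 a := bsum N (fun X => bsum N (fun Y =>
  bit B1 X && bit B2 Y && (dig M T (X * N + Y) == a))).
Definition is_extractor N M K R T := bsum M (fun a => bsum (2 ^ N) (fun B1 =>
  bsum (2 ^ N) (fun B2 => [&& card_mask N B1 <= K, card_mask N B2 <= K &
    R < cells N M T B1 B2 a]))) == 0.
Definition extractor N M K R := bmin (M ^ (N * N)) (is_extractor N M K R).

Lemma comp_bit : comp2 bit.
Proof. by rewrite /bit; auto 20 with comp. Qed.
#[local] Hint Resolve comp_bit : comp.
Lemma comp_card_mask : comp2 card_mask.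
Proof. by rewrite /card_mask; auto 20 with comp. Qed.
#[local] Hint Resolve comp_card_mask : comp.
Lemma comp_cells : comp6 cells.
Proof. by rewrite /cells; auto 40 with comp. Qed.
#[local] Hint Resolve comp_cells : comp.
Lemma comp_is_extractor : comp5 is_extractor.
Proof. by rewrite /is_extractor; auto 40 with comp. Qed.
#[local] Hint Resolve comp_is_extractor : comp.
Lemma comp_extractor : comp4 extractor.
Proof. by rewrite /extractor; auto 40 with comp. Qed.
#[export] Hint Resolve comp_extractor : comp.

Lemma dig_exists M n F : (forall c, c < n -> F c < M) ->
  exists2 T, T < M ^ n & forall c, c < n -> dig M T c = F c.
Proof.
elim: n => [|n IH] lt; first by exists 0.
have [c cn|T Tn HT] := IH; first exact/lt/ltnW.
have M0 : 0 < M by apply: leq_trans (lt n _).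
exists (T + F n * M ^ n) => [|c].
  rewrite expnS; have := lt n (ltnSn n); have := expn_gt0 M n; rewrite M0 /=; nia.
rewrite ltnS leq_eqVlt => /orP[/eqP->|cn]; rewrite /dig.
  by rewrite addnC divnMDl ?expn_gt0 ?M0 // divn_small // addn0 modn_small ?lt.
rewrite -(HT _ cn) /dig addnC.
have -> : F n * M ^ n = F n * M ^ (n - c.+1) * M * M ^ c.
  by rewrite -!mulnA -expnS -expnD; congr (_ * M ^ _); lia.
by rewrite divnMDl ?expn_gt0 ?M0 // modnMDl.
Qed.

Lemma mask_exists N (P : pred nat) :
  exists2 B, B < 2 ^ N & forall X, X < N -> bit B X = P X.
Proof.
have [X _|B BN HB] := @dig_exists 2 N P; first exact: leq_b1.
exists B => // X /HB; rewrite /dig modn2 /bit.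
by case: (odd _); case: (P X).
Qed.

Lemma extractorP N M K R : 0 < M ->
  N.+1 ^ K * (N.+1 ^ K * ('C(K * K, R) * M)) < M ^ R ->
  extractor N M K R < M ^ (N * N) /\ is_extractor N M K R (extractor N M K R).
Proof.
move=> M0 counts; have [E HE] := extractor_exists counts M0.
suff : extractor N M K R < M ^ (N * N) by move=> lt; split => //; have [] := bminP lt.
apply: bmin_exists.
have cellN X Y : X < N -> Y < N -> X * N + Y < N * N by nia.
pose F c := if insub (c %/ N) is Some i then if insub (c %% N) is Some j then
  E (i : 'I_N, j : 'I_N) : nat else 0 else 0.
have [c _|T TN HT] := @dig_exists M (N * N) F.
  by rewrite /F; case: insub => [i|//]; case: insub.
exists T => //; rewrite /is_extractor bsumn_eq0; apply/forallP => -[a aM] /=.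
rewrite bsumn_eq0; apply/forallP => -[B1 _] /=.
rewrite bsum_eq0; apply/forallP => -[B2 _] /=.
apply/negP => /and3P[s1 s2]; rewrite ltnNge => /negP; apply.
pose S B := [set i : 'I_N | bit B i].
have cardS B : #|S B| = card_mask N B.
  by rewrite /card_mask /bsum sum_indicator.
apply: leq_trans (HE (S B1) (S B2) (Ordinal aM) _ _); rewrite ?cardS //.
rewrite /cells /bsum pair_big /= sum_indicator.
apply: eq_leq; apply: eq_card => -[i j]; rewrite !inE /= HT ?cellN //.
congr (_ && _); rewrite -val_eqE /F /=.
have N0 : 0 < N by apply: leq_trans (ltn_ord i).
by rewrite divnMDl // divn_small // addn0 modnMDl modn_small // !valK.
Qed.

(** * Colour counts in rectangles given by lists *)

Lemma perm_filter_iota N (l : seq nat) : uniq l -> (forall X, X \in l -> X < N) ->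
  perm_eq l [seq X <- iota 0 N | X \in l].
Proof.
move=> ul lN; apply: uniq_perm => //; first exact/filter_uniq/iota_uniq.
move=> X; rewrite mem_filter mem_iota add0n /=.
by case: (boolP (X \in l)) => // /lN ->.
Qed.

Lemma big_list_bsum N (l : seq nat) (F : nat -> nat) : uniq l ->
  (forall X, X \in l -> X < N) -> \sum_(X <- l) F X = bsum N (fun X => (X \in l) * F X).
Proof.
move=> ul lN; rewrite (perm_big _ (perm_filter_iota ul lN)) big_filter /bsum.
rewrite -(big_mkord xpredT (fun X => (X \in l) * F X)) /index_iota subn0 big_mkcond /=.
by apply: eq_bigr => X _; case: (X \in l); rewrite ?mul1n.
Qed.

Section Lists.
Variables N M K R T : nat.
Hypotheses (K0 : 0 < K) (HT : is_extractor N M K R T).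

Definition list_cells (l1 l2 : seq nat) a :=
  \sum_(X <- l1) \sum_(Y <- l2) (dig M T (X * N + Y) == a).

Lemma list_cells_small l1 l2 a : a < M -> uniq l1 -> uniq l2 ->
  (forall X, X \in l1 -> X < N) -> (forall X, X \in l2 -> X < N) ->
  size l1 <= K -> size l2 <= K -> list_cells l1 l2 a <= R.
Proof.
move=> aM u1 u2 b1 b2 s1 s2.
have [B1 B1N HB1] := mask_exists N (mem l1); have [B2 B2N HB2] := mask_exists N (mem l2).
have cardB l B : uniq l -> (forall X, X \in l -> X < N) ->
    (forall X, X < N -> bit B X = (X \in l)) -> card_mask N B = size l.
  move=> ul lN HB; rewrite -sum1_size (big_list_bsum _ ul lN); apply: eq_bsum => X XN.
  by rewrite HB // muln1.
have := HT; rewrite /is_extractor bsumn_eq0 => /forallP /(_ (Ordinal aM)) /=.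
rewrite bsumn_eq0 => /forallP /(_ (Ordinal B1N)) /=.
rewrite bsum_eq0 => /forallP /(_ (Ordinal B2N)) /=.
rewrite (cardB l1) // (cardB l2) // s1 s2 /= -leqNgt; apply: leq_trans.
rewrite /list_cells (big_list_bsum _ u1 b1) /cells; apply: eq_leq; apply: eq_bsum => X XN.
rewrite (big_list_bsum _ u2 b2) HB1 // /= ; case: (X \in l1); rewrite ?mul1n ?mul0n.
  by apply: eq_bsum => Y YN; rewrite HB2 //=; case: (Y \in l2); case: (_ == a).
by rewrite /bsum big1.
Qed.

Lemma list_cells_cat1 l1 l1' l2 a :
  list_cells (l1 ++ l1') l2 a = list_cells l1 l2 a + list_cells l1' l2 a.
Proof. by rewrite /list_cells big_cat. Qed.

Lemma list_cells_cat2 l1 l2 l2' a :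
  list_cells l1 (l2 ++ l2') a = list_cells l1 l2 a + list_cells l1 l2' a.
Proof. by rewrite /list_cells -big_split; apply: eq_bigr => X _; rewrite big_cat. Qed.

(* Cut [l] into at most [size l %/ K + 1] pieces of length at most [K]. *)
Lemma chunk_bound (f : seq nat -> nat) (P : seq nat -> Prop) B :
  (forall l l', f (l ++ l') = f l + f l') ->
  (forall l l', P (l ++ l') -> P l /\ P l') ->
  (forall l, P l -> size l <= K -> f l <= B) ->
  forall l, P l -> K * f l <= (size l + K) * B.
Proof.
move=> fD PD fB l; have [n] := ubnP (size l); elim: n l => // n IH l ln Pl.
case: (leqP (size l) K) => [lK|Kl].
  by apply: (@leq_trans (K * B)); rewrite leq_mul ?fB // leq_addl.
move: Pl; rewrite -[l in P l](cat_take_drop K) => /PD[P1 P2].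
rewrite -{1}[l](cat_take_drop K) fD mulnDr.
have sd : size (drop K l) = size l - K by rewrite size_drop.
have := IH _ _ P2; rewrite sd => /(_ ltac:(lia)).
have := fB _ P1; rewrite size_take Kl => /(_ (leqnn _)) h1 h2.
have : K * f (take K l) <= K * B by rewrite leq_mul.
by nia.
Qed.

(** Each side in turn is cut into pieces of length at most [K]; the added [K] pays for an incomplete
    last piece. *)
Lemma list_cells_bound l1 l2 a : a < M -> uniq l1 -> uniq l2 ->
  (forall X, X \in l1 -> X < N) -> (forall X, X \in l2 -> X < N) ->
  K * K * list_cells l1 l2 a <= (size l1 + K) * (size l2 + K) * R.
Proof.
move=> aM u1 u2 b1 b2.
pose P (l : seq nat) := uniq l /\ forall X, X \in l -> X < N.
have PD l l' : P (l ++ l') -> P l /\ P l'.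
  case; rewrite cat_uniq => /and3P[ul _ ul'] bl; split; split=> // X Xl; apply: bl;
  by rewrite mem_cat Xl ?orbT.
have step l2' : P l2' -> size l2' <= K -> K * list_cells l1 l2' a <= (size l1 + K) * R.
  case=> u2' b2' s2'.
  apply: (@chunk_bound (fun l => list_cells l l2' a) P) => //.
  - by move=> l l'; apply: list_cells_cat1.
  - by move=> l [ul bl] sl; apply: list_cells_small.
rewrite -mulnA [_ * _ * R]mulnAC [_ * R * _]mulnC.
rewrite [K * list_cells _ _ _]mulnC.
apply: leq_trans (@chunk_bound (fun l => list_cells l1 l a * K) P _ _ _ _ _ _) _ => //.
- by move=> l l'; rewrite list_cells_cat2 mulnDl.
- by move=> l Pl sl; rewrite mulnC; apply: step.
Qed.
End Lists.

(** * Parameters of the tables *)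

Lemma ffact_le_exp n k : n ^_ k <= n ^ k.
Proof.
elim: k => [|k IH]; first by rewrite ffactn0.
by rewrite ffactnSr expnSr leq_mul // leq_subr.
Qed.

(** With [R = 2 ^ r], ['C(n, R) <= n ^ R / R! <= (4 * n / R) ^ R], and here [4 * n / R = M / 2]. *)
Lemma bin_pow2_bound n M r : 8 * n = 2 ^ r * M -> 'C(n, 2 ^ r) * 2 ^ (2 ^ r) <= M ^ (2 ^ r).
Proof.
set R := 2 ^ r => E; have R0 : 0 < R by rewrite expn_gt0.
rewrite -(@leq_pmul2r (R ^ R)) ?expn_gt0 ?R0 // -expnMn [M * R]mulnC -E.
apply: (@leq_trans (4 ^ R * n ^ R * 2 ^ R)); last first.
  by rewrite -!expnMn; apply: eq_leq; congr (_ ^ R); lia.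
rewrite mulnAC leq_mul2r; apply/orP; right.
apply: leq_trans (leq_mul (leqnn _) (pow2_le_fact r)) _.
by rewrite -/R mulnCA leq_mul2l bin_ffact ffact_le_exp orbT.
Qed.

(** The parameters satisfy [8 * (K * K) = R * M] with [R] a power of two. The binomial bound then
    saves a factor [2 ^ R], which exceeds the at most [2 ^ (2 * (t + 2) * K + m)] choices of two
    sides and a colour. *)
Lemma extractor_counts s m t M N K R : t = 2 ^ s -> M = 2 ^ m ->
  N = 2 ^ t.+1 -> K = 4 * M * t -> R = 128 * M * t ^ 2 ->
  N.+1 ^ K * (N.+1 ^ K * ('C(K * K, R) * M)) < M ^ R.
Proof.
move=> tE ME NE KE RE.
have M0 : 0 < M by rewrite ME expn_gt0.
have t0 : 0 < t by rewrite tE expn_gt0.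
have R2 : R = 2 ^ (7 + m + s * 2) by rewrite !expnD expnM RE ME tE.
have C : 'C(K * K, R) * 2 ^ R <= M ^ R.
  have := @bin_pow2_bound (K * K) M (7 + m + s * 2); rewrite -R2; apply.
  by rewrite RE KE -mulnn; lia.
have small : N.+1 ^ K * N.+1 ^ K * M < 2 ^ R.
  have NE' : N.+1 <= 2 ^ t.+2.
    have N0 : 0 < N by rewrite NE expn_gt0.
    by rewrite (expnS 2 t.+1) -NE; lia.
  have NK : N.+1 ^ K <= 2 ^ (t.+2 * K) by rewrite expnM leq_exp2r // KE muln_gt0 t0 muln_gt0 M0.
  apply: leq_ltn_trans (leq_mul (leq_mul NK NK) (leqnn _)) _.
  rewrite ME -!expnD ltn_exp2l // KE RE -mulnn.
  have mM : m < M by rewrite ME ltn_expl.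
  have h1 : M * t <= M * (t * t) by rewrite leq_mul // leq_pmulr.
  have h2 : M <= M * t by rewrite leq_pmulr.
  clear -mM h1 h2; nia.
have [->|C0] := posnP 'C(K * K, R); first by rewrite mul0n !muln0 expn_gt0 M0.
rewrite (_ : _ * _ = 'C(K * K, R) * (N.+1 ^ K * N.+1 ^ K * M)); last by lia.
by apply: leq_trans C; rewrite ltn_mul2l C0.
Qed.

(** * The transformation *)

(* [Q] stands for [code_rat tau], and all that matters is [tau >= 1 / Q]: the factor
   [2 ^ Q.+1 >= 2 * Q] between consecutive lengths [tlen Q j] leaves a prefix of length
   [tlen Q j.+1] with at least [2 * tlen Q j] bits of complexity.  The block length [blen j] is
   chosen to dominate [log (tlen Q j)], linear in [j], and to be negligible against the
   total length [j ^ 3] of the earlier blocks. *)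
Definition blen j := j.+1 ^ 3 - j ^ 3.
Definition tlen Q j := 2 ^ (Q.+1 * j).
(* Strings [u] of length [tlen Q j.+1] are indexed by [beta u], whence the [.+1]. *)
Definition Ncol Q j := 2 ^ (tlen Q j.+1).+1.
Definition Kcol Q j := 4 * 2 ^ blen j * tlen Q j.+1.
Definition Rcol Q j := 128 * 2 ^ blen j * tlen Q j.+1 ^ 2.
Definition zcol Q j X Y := dig (2 ^ blen j)
  (extractor (Ncol Q j) (2 ^ blen j) (Kcol Q j) (Rcol Q j)) (X * Ncol Q j + Y).

Lemma comp_blen : comp1 blen.
Proof. by rewrite /blen; auto 40 with comp. Qed.
#[export] Hint Resolve comp_blen : comp.
Lemma comp_tlen : comp2 tlen.
Proof. by rewrite /tlen; auto 40 with comp. Qed.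
#[export] Hint Resolve comp_tlen : comp.
Lemma comp_col : comp4 zcol.
Proof. by rewrite /zcol /Ncol /Kcol /Rcol; auto 40 with comp. Qed.
#[export] Hint Resolve comp_col : comp.

Lemma col_lt Q j X Y : zcol Q j X Y < 2 ^ blen j.
Proof. by rewrite ltn_mod expn_gt0. Qed.

(** As [R / K ^ 2 = 8 / 2 ^ blen j], every colour has at most 8 times the average frequency, up to
    rounding by [Kcol]. *)
Lemma col_bound Q j l1 l2 a : a < 2 ^ blen j -> uniq l1 -> uniq l2 ->
  (forall X, X \in l1 -> X < Ncol Q j) -> (forall X, X \in l2 -> X < Ncol Q j) ->
  2 ^ blen j * \sum_(X <- l1) \sum_(Y <- l2) (zcol Q j X Y == a)
    <= 8 * (size l1 + Kcol Q j) * (size l2 + Kcol Q j).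
Proof.
move=> aM u1 u2 b1 b2.
have M0 : 0 < 2 ^ blen j by rewrite expn_gt0.
have t0 : 0 < tlen Q j.+1 by rewrite expn_gt0.
have K0 : 0 < Kcol Q j by rewrite /Kcol !muln_gt0 M0 t0.
have [_ H] := extractorP M0
  (@extractor_counts (Q.+1 * j.+1) _ _ _ _ _ _ erefl erefl erefl erefl erefl).
have := list_cells_bound K0 H aM u1 u2 b1 b2.
rewrite /list_cells -/(tlen Q j.+1) -/(Kcol Q j) -/(Rcol Q j) -/(Ncol Q j) -/(zcol Q j _ _) => h.
rewrite -(@leq_pmul2r (Rcol Q j)); last by rewrite /Rcol !muln_gt0 !expn_gt0.
have E : 2 ^ blen j * Rcol Q j = 8 * (Kcol Q j * Kcol Q j) by rewrite /Rcol /Kcol; lia.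
rewrite mulnAC E -[in leqRHS]mulnA -!(mulnA 8) leq_mul2l /=.
by move: h; rewrite mulnA.
Qed.

(** For blocks [f l] of [blen l] bits, this is [beta] of the concatenation of the first [j]; the
    start value 1 is the leading digit. *)
Definition zacc (f : nat -> nat) j := prec 1 (fun l acc => acc * 2 ^ blen l + f l) j.
(** [X] and [Y] stand for strings of length [tlen Q J]; the divisions cut them to their prefixes of
    length [tlen Q l.+1]. *)
Definition zb Q J j X Y := zacc (fun l =>
  zcol Q l (X %/ 2 ^ (tlen Q J - tlen Q l.+1)) (Y %/ 2 ^ (tlen Q J - tlen Q l.+1))) j.

Lemma comp_zb : comp5 zb.
Proof. by rewrite /zb /zacc; auto 40 with comp. Qed.
#[export] Hint Resolve comp_zb : comp.

Lemma eq_zacc f g j : (forall l, l < j -> f l = g l) -> zacc f j = zacc g j.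
Proof. by move=> H; apply: eq_prec => i a lt; rewrite H. Qed.

Definition block Q (x y : bitstream) l :=
  zcol Q l (beta (prefix x (tlen Q l.+1))) (beta (prefix y (tlen Q l.+1))).

Lemma beta_prefixS x n : beta (prefix x n.+1) = (beta (prefix x n)).*2 + x n.
Proof. by rewrite /prefix mkseqS beta_rcons. Qed.

Lemma beta_prefix_div x n k : k <= n ->
  beta (prefix x n) %/ 2 ^ (n - k) = beta (prefix x k).
Proof.
move=> /subnK <-; rewrite addnK; elim: (n - k) => [|d IH]; first by rewrite divn1.
rewrite addSn beta_prefixS expnS divnMA -IH; congr (_ %/ _); lia.
Qed.

Lemma tlen_le Q i j : i <= j -> tlen Q i <= tlen Q j.
Proof. by move=> ij; rewrite leq_exp2l // leq_mul. Qed.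

Lemma zb_prefix Q J j x y : j <= J ->
  zb Q J j (beta (prefix x (tlen Q J))) (beta (prefix y (tlen Q J))) = zacc (block Q x y) j.
Proof.
move=> jJ; apply: eq_zacc => l lj.
by rewrite !beta_prefix_div ?tlen_le //; apply: leq_trans jJ.
Qed.

(** The integer cube root, which is the index of the block containing bit [n], since the first [j]
    blocks have [j ^ 3] bits. *)
Definition croot n := bsum n (fun l => l.+1 ^ 3 <= n).
Definition zbit Q n X Y :=
  odd (zcol Q (croot n) X Y %/ 2 ^ (blen (croot n) - (n - croot n ^ 3).+1)).

Lemma comp_croot : comp1 croot.
Proof. by rewrite /croot; auto 40 with comp. Qed.
#[export] Hint Resolve comp_croot : comp.
Lemma comp_zbit : comp4 zbit.
Proof. by rewrite /zbit; auto 40 with comp. Qed.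
#[export] Hint Resolve comp_zbit : comp.

Lemma blenE j : j.+1 ^ 3 = j ^ 3 + blen j.
Proof. by rewrite /blen subnKC // leq_exp2r. Qed.

Lemma crootE j r : r < blen j -> croot (j ^ 3 + r) = j.
Proof.
move=> rj; rewrite -[RHS](@bsum_lt (j ^ 3 + r)); last first.
  by apply: leq_trans (leq_addr _ _); case: j {rj} => // j; rewrite -{1}(expn1 j.+1) leq_pexp2l.
apply: eq_bsum => i _; congr nat_of_bool; apply/idP/idP => [le|ij].
  rewrite ltnNge; apply/negP => ji.
  have : j.+1 ^ 3 <= i.+1 ^ 3 by rewrite leq_exp2r.
  by rewrite blenE; lia.
by apply: leq_trans (leq_addr _ _); rewrite leq_exp2r.
Qed.

Definition zseq Q (x y : bitstream) n := zbit Q n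
  (beta (prefix x (tlen Q (croot n).+1))) (beta (prefix y (tlen Q (croot n).+1))).

Lemma beta_zseq Q x y j : beta (prefix (zseq Q x y) (j ^ 3)) = zacc (block Q x y) j.
Proof.
elim: j => [|j IH]; first by [].
(* The bits of a block are read from the most significant one, so its first [r] bits form a
   quotient. *)
suff H r : r <= blen j -> beta (prefix (zseq Q x y) (j ^ 3 + r)) =
    zacc (block Q x y) j * 2 ^ r + block Q x y j %/ 2 ^ (blen j - r).
  by rewrite blenE H // subnn divn1.
elim: r => [|r IHr] lt.
  by rewrite addn0 subn0 muln1 IH divn_small ?col_lt // addn0.
rewrite addnS beta_prefixS IHr ?(ltnW lt) // /zseq crootE // /zbit crootE //.
rewrite addKn -/(block Q x y j).
have -> : 2 ^ (blen j - r) = 2 ^ (blen j - r.+1) * 2 by rewrite -expnSr; congr (_ ^ _); lia.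
rewrite divnMA expnS; move: (_ %/ 2 ^ (blen j - r.+1)) => v; lia.
Qed.

Lemma prefix_code (or : code) (x : bitstream * bitstream -> nat -> bool) :
  (forall ox oy n, eval ox oy or [:: n] (x (ox, oy) n)) ->
  exists c, forall ox oy n, eval ox oy c [:: n] (beta (prefix (x (ox, oy)) n)).
Proof.
move=> Hor; have [c2 Hc2] : computable 2 (fun v => (nth 0 v 0).*2 + nth 0 v 1).
  by apply: comp_ext (comp2D (comp2M (comp_const 2 2) (comp_nth 2 0)) (comp_nth 2 1)) _ => v _; lia.
have [c1 Hc1] := comp_const 0 1.
exists (Prec c1 (Comp c2 [:: Proj 1; Comp or [:: Proj 0]])) => ox oy n.
elim: n => [|n IH]; first by apply: ePrec0; apply: Hc1.
apply: ePrecS IH _; rewrite beta_prefixS.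
apply: (@eComp _ _ _ _ _ [:: beta (prefix (x (ox, oy)) n); nat_of_bool (x (ox, oy) n)]).
  2: exact: Hc2.
constructor; first exact: (eProj _ _ 1).
constructor; last by constructor.
apply: (@eComp _ _ _ _ _ [:: n]); last exact: Hor.
by constructor; [exact: (eProj _ _ 0)|constructor].
Qed.

(** Only the two prefixes depend on the oracles. Evaluation succeeds for all oracles and all [Q],
    which also yields the truth-table property. *)
Lemma zseq_code : exists Mf : code, forall x y Q n,
  eval x y Mf [:: Q; n] (nat_of_bool (zseq Q x y n)).
Proof.
have [cx Hx] := @prefix_code OrX (fun o => o.1) (fun ox oy n => eOrX ox oy [:: n]).
have [cy Hy] := @prefix_code OrY (fun o => o.2) (fun ox oy n => eOrY ox oy [:: n]).
have [ct Ht] : computable 2 (fun v => tlen (nth 0 v 0) (croot (nth 0 v 1)).+1).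
  by auto with comp.
have [cz Hz] : computable 4 (fun v => zbit (nth 0 v 0) (nth 0 v 1) (nth 0 v 2) (nth 0 v 3)).
  by auto with comp.
exists (Comp cz [:: Proj 0; Proj 1; Comp cx [:: ct]; Comp cy [:: ct]]) => x y Q n.
set t := tlen Q (croot n).+1.
apply: (@eComp _ _ _ _ _ [:: Q; n; beta (prefix x t); beta (prefix y t)]); last exact: Hz.
have Ht' : evals x y [:: ct] [:: Q; n] [:: t].
  by constructor; [apply: (Ht x y [:: Q; n])|constructor].
apply: esCons; first exact: (eProj _ _ 0).
apply: esCons; first exact: (eProj _ _ 1).
apply: esCons; first exact: eComp Ht' (Hx x y t).
by apply: esCons; [exact: eComp Ht' (Hy x y t)|exact: esNil].
Qed.

(** * Counting the pairs with a rare colour *)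

Lemma big_fiber (L : seq nat) (f G : nat -> nat) n : (forall X, X \in L -> f X < n) ->
  \sum_(X <- L) G X = \sum_(u < n) \sum_(X <- [seq X <- L | f X == u]) G X.
Proof.
move=> fn; under [RHS]eq_bigr => u _ do rewrite big_filter big_mkcond.
rewrite exchange_big; apply: eq_big_seq => X /fn lt.
rewrite (bigD1 (Ordinal lt)) //= eqxx big1 ?addn0 // => u.
by rewrite -val_eqE /= eq_sym => /negbTE ->.
Qed.

Lemma size_fiber (L : seq nat) (f : nat -> nat) n : (forall X, X \in L -> f X < n) ->
  size L = \sum_(u < n) size [seq X <- L | f X == u].
Proof.
by move=> fn; rewrite -sum1_size (big_fiber _ fn); apply: eq_bigr => u _; rewrite sum1_size.
Qed.

Lemma sum_eq_lt M (w : nat) : \sum_(c < M) (w == c :> nat) = (w < M).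
Proof.
case: ltnP => [lt|le].
  rewrite (bigD1 (Ordinal lt)) //= eqxx big1 // => c.
  by rewrite -val_eqE eq_sym /= => /negbTE ->.
by rewrite big1 // => c _; case: eqP => // E; have := ltn_ord c; rewrite -E ltnNge le.
Qed.

(** The allowed colours vary with [f X] and [f Y], so the rectangle is split along the fibres of
    [f]. On each part at most [be / al] colours are allowed, and [col_bound] applies to each of
    them; every fibre contributes one rounding term [Kcol]. *)
Lemma fiber_col_count Q j L1 L2 f n (A : nat -> nat -> pred nat) al be :
  uniq L1 -> uniq L2 ->
  (forall X, X \in L1 -> X < Ncol Q j) -> (forall X, X \in L2 -> X < Ncol Q j) ->
  (forall X, X \in L1 -> f X < n) -> (forall X, X \in L2 -> f X < n) ->
  (forall u v, al * \sum_(c < 2 ^ blen j) A u v c <= be) ->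
  al * (2 ^ blen j * \sum_(X <- L1) \sum_(Y <- L2) A (f X) (f Y) (zcol Q j X Y))
    <= be * (8 * (size L1 + n * Kcol Q j) * (size L2 + n * Kcol Q j)).
Proof.
move=> u1 u2 b1 b2 f1 f2 HA; set M := 2 ^ blen j; set K := Kcol Q j.
pose F (L : seq nat) u := [seq X <- L | f X == u].
have szF (L : seq nat) : (forall X, X \in L -> f X < n) ->
    size L + n * K = \sum_(u < n) (size (F L u) + K).
  by move=> fn; rewrite big_split /= sum_nat_const card_ord -size_fiber.
rewrite (szF _ f1) (szF _ f2) (big_fiber _ f1).
have -> : \sum_(u < n) \sum_(X <- F L1 u) \sum_(Y <- L2) A (f X) (f Y) (zcol Q j X Y) =
    \sum_(u < n) \sum_(v < n) \sum_(X <- F L1 u) \sum_(Y <- F L2 v) (A u v (zcol Q j X Y) : nat).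
  apply: eq_bigr => u _; rewrite [RHS]exchange_big; apply: eq_big_seq => X.
  rewrite mem_filter => /andP[/eqP <- _]; rewrite (big_fiber _ f2).
  by apply: eq_bigr => v _; apply: eq_big_seq => Y; rewrite mem_filter => /andP[/eqP <- _].
rewrite -mulnA big_distrlr /= !big_distrr /=; apply: leq_sum => u _.
rewrite !big_distrr /=; apply: leq_sum => v _.
have cols X Y : A u v (zcol Q j X Y) = \sum_(c < M) A u v c * (zcol Q j X Y == c :> nat) :> nat.
  rewrite (bigD1 (Ordinal (col_lt Q j X Y))) //= eqxx muln1 big1 ?addn0 // => c.
  by rewrite -val_eqE eq_sym /= => /negbTE ->; rewrite muln0.
apply: leq_trans (leq_mul (HA u v) (leqnn _)).
rewrite -mulnA leq_mul2l; apply/orP; right.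
rewrite (eq_bigr (fun X => \sum_(c < M) A u v c * \sum_(Y <- F L2 v)
    (zcol Q j X Y == c :> nat))) => [|X _]; last first.
  rewrite (eq_bigr _ (fun Y _ => cols X Y)) exchange_big.
  by apply: eq_bigr => c _; rewrite big_distrr.
rewrite exchange_big big_distrr big_distrl /=; apply: leq_sum => c _.
rewrite -big_distrr /= mulnCA leq_mul2l; apply/orP; right; rewrite mulnA.
apply: (col_bound (ltn_ord c)); rewrite ?filter_uniq // => X.
  by rewrite mem_filter => /andP[_ /b1].
by rewrite mem_filter => /andP[_ /b2].
Qed.

(** * Programs counted by the prefixes of their outputs *)

Section Counting.
Variables (U : code) (HU : universal U).

(* [Ub s p] is [beta] of the output of the program with number [p], or [0]. *)
Definition Ub s p := ev U s [:: p].

Lemma comp_Ub : comp2 Ub.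
Proof.
move=> k f g Hf Hg.
apply: (@comp_app k 2 (fun v => ev U (head 0 v) (behead v)) [:: f; g]) => //.
  exact: comp_ev.
by case=> [|[|i]].
Qed.
#[local] Hint Resolve comp_Ub : comp.

Lemma Ub_mono s s' p : s <= s' -> 0 < Ub s p -> Ub s' p = Ub s p.
Proof.
by rewrite /Ub => le; case E: (ev U s _) => [|r] // _; apply: ev_mono le E.
Qed.

(* The number of programs of length at most [k] whose output, without its last [h] bits,
   is the string [u] with [beta u = sigma]. *)
Definition W s k h sigma := bsum (2 ^ k.+1) (fun p => Ub s p %/ 2 ^ h == sigma).

Lemma comp_W : comp4 W.
Proof. by rewrite /W; auto 40 with comp. Qed.
#[local] Hint Resolve comp_W : comp.

Lemma W_le s k h sigma : W s k h sigma <= 2 ^ k.+1.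
Proof.
apply: leq_trans (_ : bsum (2 ^ k.+1) (fun=> 1) <= _).
  by apply: leq_sum => p _; apply: leq_b1.
by rewrite /bsum sum_nat_const card_ord muln1.
Qed.

(** As [sigma] is positive, only programs that have halted are counted, and they keep their
    outputs. *)
Lemma W_mono s s' k h sigma : 0 < sigma -> s <= s' -> W s k h sigma <= W s' k h sigma.
Proof.
move=> s0 le; apply: leq_sum => p _; case: eqP => // E.
by rewrite (Ub_mono le) ?E ?eqxx //; case: (Ub s p) E => // E; rewrite -E div0n in s0.
Qed.

(** Each program is counted for at most one [c], and then also for [sigma]. *)
Lemma W_split s k h m sigma :
  \sum_(c < 2 ^ m) W s k h (sigma * 2 ^ m + c) <= W s k (h + m) sigma.
Proof.
rewrite /W /bsum exchange_big; apply: leq_sum => p _.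
rewrite expnD divnMA; set w := _ %/ 2 ^ h.
have M0 : 0 < 2 ^ m by rewrite expn_gt0.
case: eqP => [E|ne]; last first.
  rewrite big1 // => c _; case: eqP => // E; case: ne.
  by rewrite E divnMDl // divn_small ?addn0.
rewrite (eq_bigr (fun c : 'I_(2 ^ m) => (w %% 2 ^ m == c :> nat) : nat)) => [|c _].
  by rewrite sum_eq_lt leq_b1.
by rewrite {1}(divn_eq w (2 ^ m)) E eqn_add2l.
Qed.

Definition heavy S k h h' th th' sigma M c := 0 < bsum S.+1 (fun s =>
  (2 ^ th <= W s k h (sigma * M + c)) && (W s k h' sigma <= 2 ^ th')).

(* The second condition in [heavy] is lost as the stage grows, while the first is gained:
   all heavy colours are so at the last stage that satisfies the second condition. *)
Lemma heavy_count S k h m th th' sigma : 0 < sigma ->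
  2 ^ th * \sum_(c < 2 ^ m) heavy S k h (h + m) th th' sigma (2 ^ m) c <= 2 ^ th'.
Proof.
move=> s0; have [|none] := boolP [exists s : 'I_S.+1, W s k (h + m) sigma <= 2 ^ th'].
  move=> /existsP [[s0' lt0] /= v0].
  have ex : exists s, (s < S.+1) && (W s k (h + m) sigma <= 2 ^ th') by exists s0'; rewrite lt0.
  have ub s : (s < S.+1) && (W s k (h + m) sigma <= 2 ^ th') -> s <= S by case/andP.
  case: (ex_maxnP ex ub) => s /andP[sS vs] max.
  apply: leq_trans vs; apply: leq_trans (W_split _ _ _ _ _).
  rewrite big_distrr; apply: leq_sum => c _.
  rewrite /heavy /=; case: bsum_gt0P => [[s' s'S /andP[le v']]|_] /=; last by rewrite muln0.
  rewrite muln1; apply: leq_trans le (W_mono _ _ _ _).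
    by rewrite addn_gt0 muln_gt0 s0 expn_gt0.
  by apply: max; rewrite s'S.
rewrite big1 ?muln0 // => c _; rewrite /heavy; case: bsum_gt0P => // -[s sS /andP[_ v]].
by case/negP: none; apply/existsP; exists (Ordinal sS).
Qed.

(** The range of [p] covers all programs of length at most [a]; [X] is [beta] of the output. *)
Definition Kat s a X := 0 < bsum (2 ^ a.+1) (fun p => Ub s p == X).

Lemma comp_Kat : comp3 Kat.
Proof. by rewrite /Kat; auto 40 with comp. Qed.
#[local] Hint Resolve comp_Kat : comp.

(** The range of [beta] on strings of length [t]. *)
Definition has_len t X := (2 ^ t <= X) && (X < 2 ^ t.+1).

(** The set to be enumerated over all stages [s]: pairs of strings of low complexity whose colour is
    heavy given the first [j] blocks. The subtractions give the number of bits beyond a block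
    boundary in a string of length [len]. *)
Definition cand Q j len k th th' a b s X Y :=
  [&& has_len (tlen Q j.+1) X, has_len (tlen Q j.+1) Y, Kat s a X, Kat s b Y,
      2 ^ th <= W s k (len - j.+1 ^ 3) (zb Q j.+1 j.+1 X Y) &
      W s k (len - j ^ 3) (zb Q j.+1 j X Y) <= 2 ^ th'].

Lemma zacc_gt0 f j : 0 < zacc f j.
Proof. by elim: j => //= j IH; rewrite addn_gt0 muln_gt0 [0 < prec _ _ _]IH expn_gt0. Qed.

(** The prefixes of length [tlen Q j] determine the first [j] blocks, hence the heavy colours. So
    [fiber_col_count] applies with truncation to these prefixes, and [heavy_count] bounds the
    allowed colours. *)
Lemma cand_count Q j len k th th' a b (r : seq (nat * nat)) : j.+1 ^ 3 <= len -> uniq r ->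
  (forall XY, XY \in r -> exists s, cand Q j len k th th' a b s XY.1 XY.2) ->
  2 ^ th * (2 ^ blen j * size r) <= 2 ^ th' *
    (8 * (2 ^ a.+1 + 2 ^ (tlen Q j).+1 * Kcol Q j) * (2 ^ b.+1 + 2 ^ (tlen Q j).+1 * Kcol Q j)).
Proof.
move=> jlen ur Hr.
(* [heavy] needs one last stage for all the finitely many pairs. *)
have [S HS] : exists S, forall XY, XY \in r ->
    exists2 s, s <= S & cand Q j len k th th' a b s XY.1 XY.2.
  elim: r Hr {ur} => [|XY r IH] Hr; first by exists 0.
  have [|S HS] := IH; first by move=> XY' h; apply: Hr; rewrite inE h orbT.
  have [s Hs] := Hr XY (mem_head _ _).
  exists (maxn S s) => XY'; rewrite inE => /predU1P [->|/HS [s' le c]].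
    by exists s => //; apply: leq_maxr.
  by exists s' => //; apply: leq_trans (leq_maxl _ _).
set t := tlen Q j.+1; set t' := tlen Q j; set M := 2 ^ blen j.
have tt : t' <= t by apply: tlen_le.
pose L e := [seq X <- undup [seq Ub S p | p <- iota 0 (2 ^ e.+1)] | has_len t X].
have uL e : uniq (L e) by rewrite filter_uniq ?undup_uniq.
have sL e : size (L e) <= 2 ^ e.+1.
  rewrite size_filter; apply: leq_trans (count_size _ _) _.
  by apply: leq_trans (size_undup _) _; rewrite size_map size_iota.
have bL e X : X \in L e -> X < Ncol Q j by rewrite mem_filter => /andP[/andP[_]].
pose f X := X %/ 2 ^ (t - t').
have fL e X : X \in L e -> f X < 2 ^ t'.+1.
  rewrite mem_filter => /andP[/andP[_ lt] _].
  by rewrite /f ltn_divLR ?expn_gt0 // -expnD (_ : t'.+1 + (t - t') = t.+1) //; lia.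
have KL e s X : s <= S -> has_len t X -> Kat s e X -> X \in L e.
  move=> sS hX /bsum_gt0P [p plt /eqP E]; rewrite mem_filter hX mem_undup.
  apply/mapP; exists p; first by rewrite mem_iota.
  rewrite (Ub_mono sS) ?E //; case/andP: hX => lo _; apply: leq_trans lo; exact: expn_gt0.
pose sig u v := zb Q j j u v.
pose h := len - j.+1 ^ 3.
have hE : len - j ^ 3 = h + blen j by move: jlen; rewrite /h blenE; lia.
pose A u v := heavy S k h (h + blen j) th th' (sig u v) M.
have zE X Y : zb Q j.+1 j X Y = sig (f X) (f Y).
  apply: eq_zacc => l lj; rewrite /f -!divnMA -!expnD.
  by rewrite (_ : t - t' + (t' - tlen Q l.+1) = t - tlen Q l.+1) //; have := tlen_le Q lj; lia.
have := @fiber_col_count Q j (L a) (L b) f (2 ^ t'.+1) A (2 ^ th) (2 ^ th')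
  (uL a) (uL b) (bL a) (bL b) (fL a) (fL b)
  (fun u v => heavy_count S k h (blen j) th th' (zacc_gt0 _ _)).
move=> H; apply: (@leq_trans (2 ^ th' * (8 * (size (L a) + 2 ^ t'.+1 * Kcol Q j) *
    (size (L b) + 2 ^ t'.+1 * Kcol Q j)))); last first.
  by rewrite leq_mul // leq_mul ?leq_add2r // leq_mul // leq_add2r.
apply: leq_trans H; rewrite !leq_mul2l; apply/orP; right; apply/orP; right.
pose r' := [seq XY <- [seq (X, Y) | X <- L a, Y <- L b] | A (f XY.1) (f XY.2) (zcol Q j XY.1 XY.2)].
have : size r <= size r'.
  apply: uniq_leq_size => // -[X Y] /HS [s sS /and5P[/= lX lY kX kY /andP[w1 w2]]].
  rewrite mem_filter /=; apply/andP; split; last first.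
    by apply/allpairsP; exists (X, Y); split=> //=; apply: KL sS _ _.
  apply/bsum_gt0P; exists s => //; rewrite -zE -/(h) -hE w2 andbT.
  by move: w1; rewrite /zb /zacc /= subnn !divn1.
move/leq_trans; apply; rewrite size_filter -sum1_count big_mkcond big_allpairs /=.
by apply: eq_leq; apply: eq_bigr => X _; apply: eq_bigr => Y _; case: (A _ _ _).
Qed.
End Counting.

(** * Complexity of the pair of prefixes *)

Section PairComplexity.
Variables (U : code) (HU : universal U).
#[local] Hint Resolve comp_W comp_Kat : comp.

Lemma Kat_mono s s' a X : 0 < X -> s <= s' -> Kat U s a X -> Kat U s' a X.
Proof.
move=> X0 le /bsum_gt0P [p lt /eqP E]; apply/bsum_gt0P; exists p => //.
by rewrite (Ub_mono le) ?E.
Qed.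

Lemma Kat_exists u : exists s, Kat U s (Kc U u) (beta u).
Proof.
have [[p [sp /ev_complete [s E]]] _] := Kc_spec HU u.
exists s; apply/bsum_gt0P; exists (nat_of_bits p); last by rewrite /Ub E.
by rewrite -sp; apply: leq_ltn_trans (leqnSn _) _; have /andP[] := beta_bounds p.
Qed.

(** [Kc_enum] for the set [cand]: its seven parameters, of [l] bits each, are packed into [q] and
    cost [8 * l] bits together with [l]. The rest is the logarithm of the bound in [cand_count]. *)
Lemma pair_upper Q : exists c, forall l j len k th th' a b s x y,
  [/\ j < 2 ^ l, len < 2 ^ l, k < 2 ^ l & th < 2 ^ l] ->
  [/\ th' < 2 ^ l, a < 2 ^ l & b < 2 ^ l] ->
  j.+1 ^ 3 <= len ->
  2 ^ (tlen Q j).+1 * Kcol Q j <= 2 ^ a -> 2 ^ (tlen Q j).+1 * Kcol Q j <= 2 ^ b ->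
  cand U Q j len k th th' a b s
    (beta (prefix x (tlen Q j.+1))) (beta (prefix y (tlen Q j.+1))) ->
  Kc U (prefix x (tlen Q j.+1) ++ prefix y (tlen Q j.+1)) <=
    th' + a + b + 7 - blen j - th + 8 * l + c.
Proof.
pose P l q i := dig (2 ^ l) q i.
have comp_P : comp3 P by rewrite /P; auto 20 with comp.
(* A stage [n] codes the fuel and both strings; [n.+1] is decoded because pairs are positive
   numbers. *)
pose st n := logn 2 n.+1; pose Xn n := logn 2 (oddhalf n.+1); pose Yn n := oddhalf (oddhalf n.+1).
have comp_st : comp1 st by rewrite /st; auto with comp.
have comp_X : comp1 Xn by rewrite /Xn; auto with comp.
have comp_Y : comp1 Yn by rewrite /Yn; auto with comp.
pose D l q n := cand U Q (P l q 0) (P l q 1) (P l q 2) (P l q 3) (P l q 4) (P l q 5) (P l q 6)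
  (st n) (Xn n) (Yn n).
pose o l q n := Xn n * 2 ^ tlen Q (P l q 0).+1 + Yn n - 2 ^ tlen Q (P l q 0).+1 - 1.
have HD : comp3 D.
  by rewrite /D /cand /has_len; auto 60 using comp_P, comp_st, comp_X, comp_Y with comp.
have Ho : comp3 o.
  by rewrite /o; auto 60 using comp_P, comp_X, comp_Y with comp.
have [c Hc] := Kc_enum HU 7 HD Ho.
exists c => l j len k th th' a b s x y [jl lenl kl thl] [th'l al bl] jlen Ka Kb cnd.
have [|q qB Hq] := @dig_exists (2 ^ l) 7 (nth 0 [:: j; len; k; th; th'; a; b]).
  by do 7?case=> //.
have Pq i : i < 7 -> P l q i = nth 0 [:: j; len; k; th; th'; a; b] i by apply: Hq.
set t := tlen Q j.+1 in cnd *; set X := beta (prefix x t); set Y := beta (prefix y t).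
pose n := (2 ^ s * (2 ^ X * Y.*2.+1).*2.+1).-1.
have nE : n.+1 = 2 ^ s * (2 ^ X * Y.*2.+1).*2.+1.
  by rewrite prednK // muln_gt0 expn_gt0.
have sE : st n = s by rewrite /st nE logn2_pair.
have XE : Xn n = X by rewrite /Xn nE oddhalf_pair logn2_pair.
have YE : Yn n = Y by rewrite /Yn nE !oddhalf_pair.
apply: (Hc l q n) => [|||r ur Hr].
- by rewrite mulnC expnM.
- by rewrite /D !Pq //= sE XE YE.
- rewrite /o Pq //= XE YE -/t.
  have := beta_cat (prefix x t) (prefix y t); rewrite size_mkseq -/X -/Y => <-.
  by rewrite addnK /beta subn1.
(* Strings of length [t] can be recovered from their concatenation, so distinct outputs come from
   distinct pairs. *)
pose XW w := (w + 1) %/ 2 ^ t; pose YW w := (w + 1) %% 2 ^ t + 2 ^ t.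
have Hunp w : w \in r -> XW w * 2 ^ t + YW w - 2 ^ t - 1 = w /\
    exists s, cand U Q j len k th th' a b s (XW w) (YW w).
  move=> /Hr [n' []]; rewrite /D /o !Pq //= -/t => c' E.
  have [/andP[loX _] /andP[loY upY]] : has_len t (Xn n') /\ has_len t (Yn n').
    by case/and3P: c'; rewrite -/t.
  have e : w + 1 = Xn n' * 2 ^ t + (Yn n' - 2 ^ t).
    rewrite -E; have : 0 < 2 ^ t by rewrite expn_gt0.
    by nia.
  have small : Yn n' - 2 ^ t < 2 ^ t by move: upY; rewrite expnS; lia.
  have e1 : XW w = Xn n'.
    by rewrite /XW e /= divnMDl ?expn_gt0 // divn_small // addn0.
  have e2 : YW w = Yn n' by rewrite /YW e /= modnMDl modn_small // subnK.
  by rewrite e1 e2; split=> //; exists (st n').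
have ui : uniq [seq (XW w, YW w) | w <- r].
  rewrite map_inj_in_uniq // => w w' /Hunp [E _] /Hunp [E' _] [e1 e2].
  by rewrite -E -E' e1 e2.
have Hc' XY : XY \in [seq (XW w, YW w) | w <- r] ->
    exists s, cand U Q j len k th th' a b s XY.1 XY.2.
  by case/mapP => w /Hunp [_ [s' c']] ->; exists s'.
have := cand_count jlen ui Hc'; rewrite size_map => cnt.
(* The 7 is 3 for the factor 8 and 2 for each sum, as in [2 ^ a.+1 + 2 ^ a <= 2 ^ a.+2]. *)
have {cnt} cnt : 2 ^ (th + blen j) * size r <= 2 ^ (th' + a + b + 7).
  rewrite expnD -mulnA; apply: leq_trans cnt _.
  rewrite -!addnA expnD leq_mul2l; apply/orP; right.
  rewrite (_ : a + (b + 7) = 3 + a.+2 + b.+2); last by lia.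
  rewrite !expnD; apply: leq_mul; last by rewrite (expnS 2 b.+1) (expnS 2 b); lia.
  by rewrite leq_mul2l /= (expnS 2 a.+1) (expnS 2 a); lia.
(* If the subtraction truncates a negative exponent, the count forces the list to be empty. *)
case: (leqP (th + blen j) (th' + a + b + 7)) => [le|lt].
  rewrite -(@leq_pmul2l (2 ^ (th + blen j))) ?expn_gt0 // -expnD.
  by rewrite (_ : th + blen j + _ = th' + a + b + 7) //; lia.
case: r {ur Hr Hunp ui Hc'} cnt => [|w r] //= cnt.
move: (leq_trans (leq_pmulr _ (ltn0Sn _)) cnt).
by rewrite leqNgt ltn_exp2l // lt.
Qed.
End PairComplexity.

(** * The randomness rate of the output *)

Lemma telescope (w e : nat -> nat) j0 i : j0 <= i ->
  (forall j, j0 <= j < i -> w j.+1 * 2 ^ e j <= w j) ->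
  w i * 2 ^ (\sum_(j0 <= j < i) e j) <= w j0.
Proof.
move=> /subnK <-; elim: (i - j0) => [|d IH] H; first by rewrite big_geq // muln1.
rewrite addSn big_nat_recr ?leq_addl //= [X in 2 ^ X]addnC expnD mulnA.
apply: (@leq_trans (w (d + j0) * 2 ^ (\sum_(j0 <= j < d + j0) e j))).
  by rewrite leq_mul2r H ?orbT //; lia.
by apply: IH => j /andP[lo hi]; apply: H; lia.
Qed.

Lemma cube_floor n : exists i, i ^ 3 <= n < i.+1 ^ 3.
Proof.
elim: n => [|n [i /andP[lo hi]]]; first by exists 0.
case: (ltnP n.+1 (i.+1 ^ 3)) => [lt|le]; first by exists i; lia.
exists i.+1; rewrite le /= (leq_ltn_trans hi) // ltn_exp2r //.
Qed.

Lemma cubeS i : i.+1 ^ 3 = i ^ 3 + (3 * (i * i) + 3 * i + 1).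
Proof. rewrite !expnS expn0; lia. Qed.

Lemma blen_quad j : blen j = 3 * (j * j) + 3 * j + 1.
Proof. by rewrite /blen cubeS addKn. Qed.

Lemma sum_blen j0 i : j0 <= i -> \sum_(j0 <= j < i) blen j = i ^ 3 - j0 ^ 3.
Proof.
move=> /subnK <-; elim: (i - j0) => [|d IH]; first by rewrite big_geq // subnn.
rewrite addSn big_nat_recr ?leq_addl //= IH blenE.
have : j0 ^ 3 <= (d + j0) ^ 3 by rewrite leq_exp2r // leq_addl.
lia.
Qed.

Lemma quad_le_exp v : 9 <= v -> 3 * (v * v) + 5 * v + 4 <= 2 ^ v.
Proof.
move=> /subnK <-; elim: (v - 9) => [|d IH] //.
by rewrite addSn expnS; nia.
Qed.

(** Used with [I = i ^ 3] and [J = (i %/ d) ^ 3]. The terms of lower order are absorbed into one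
    [I], which leaves [(d - 1) ^ 2 * I <= d * (d - 3) * I], a contradiction. *)
Lemma cube_gap d i I J n k : 0 < d -> 7 * d <= i -> 7 * d * (i * i) <= I -> J <= I ->
  d * J <= I -> I <= n -> n < I + (3 * (i * i) + 3 * i + 1) ->
  k * d + 4 * n < n * d -> d.-1 * (I - J) <= d * k.+1 -> False.
Proof.
move=> d0 id i3 j0le j0d lo hi small lower.
have i7 : 7 <= i by lia.
have d5 : 4 < d.
  rewrite ltnNge; apply/negP => d4.
  have : n * d <= n * 4 by rewrite leq_mul2l d4 orbT.
  by lia.
have [d' dE] : exists d', d = d'.+4 by exists (d - 4); lia.
subst d; rewrite /= in lower.
have ii : 7 * i <= i * i by rewrite leq_mul2r i7 orbT.
have h1 : d'.+4 * k <= d' * n by lia.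
have h2 : d'.+3 * (I - J) <= d' * n + d'.+4 by rewrite mulnS in lower; lia.
have h3 : d'.+3 * (d'.+3 * I) <= d'.+4 * (d'.+3 * (I - J)).
  by rewrite mulnCA leq_mul2l /= mulnBr; lia.
have h4 : n <= I + 4 * (i * i) by lia.
have h5 : d'.+3 * (d'.+3 * I) <= d'.+4 * (d' * (I + 4 * (i * i)) + d'.+4).
  apply: leq_trans h3 _; rewrite leq_mul2l; apply/orP; right; apply: leq_trans h2 _.
  by rewrite leq_add2r leq_mul2l h4 orbT.
have h7 : d' * (4 * (i * i)) + d'.+4 <= I by lia.
have h8 : d' * (I + 4 * (i * i)) + d'.+4 <= d'.+1 * I by rewrite mulnDr mulSn; lia.
have h9 : d'.+4 * (d'.+1 * I) < d'.+3 * (d'.+3 * I).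
  by rewrite !mulnA ltn_mul2r; apply/andP; split; lia.
have := leq_trans h5 (leq_mul (leqnn _) h8).
by rewrite leqNgt h9.
Qed.

Section Rate.
Variables (U : code) (HU : universal U) (Q : nat) (x y : bitstream).
Let Kx t := Kc U (prefix x t).
Let Ky t := Kc U (prefix y t).

(** The block [j] will depend on the stage, so the stage has to serve all [j < i] beforehand. *)
Lemma common_stage n i : exists s,
  Kat U s (Kc U (prefix (zseq Q x y) n)) (beta (prefix (zseq Q x y) n)) /\
  forall j, j < i -> Kat U s (Kx (tlen Q j.+1)) (beta (prefix x (tlen Q j.+1))) /\
                     Kat U s (Ky (tlen Q j.+1)) (beta (prefix y (tlen Q j.+1))).
Proof.
elim: i => [|i [s [Hz Hs]]].
  by have [s Hs] := Kat_exists HU (prefix (zseq Q x y) n); exists s.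
have [s1 H1] := Kat_exists HU (prefix x (tlen Q i.+1)).
have [s2 H2] := Kat_exists HU (prefix y (tlen Q i.+1)).
have up s' a u : s' <= maxn s (maxn s1 s2) -> Kat U s' a (beta u) ->
    Kat U (maxn s (maxn s1 s2)) a (beta u).
  by apply: Kat_mono.
exists (maxn s (maxn s1 s2)); split; first by apply: up Hz; lia.
move=> j; rewrite ltnS leq_eqVlt => /orP[/eqP->|/Hs [Hx Hy]].
  by split; [apply: up H1; lia|apply: up H2; lia].
by split; [apply: up Hx; lia|apply: up Hy; lia].
Qed.

(* Otherwise [W] would drop by more than [2 ^ k.+1] between the blocks [i %/ d] and [i]. *)
Lemma light_block d n i k s (z := zseq Q x y) : 0 < d -> 7 * d <= i ->
  i ^ 3 <= n < i.+1 ^ 3 -> k * d + 4 * n < n * d ->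
  Kat U s k (beta (prefix z n)) ->
  exists2 j, i %/ d <= j < i & 
    W U s k (n - j ^ 3) (zacc (block Q x y) j) <
    W U s k (n - j.+1 ^ 3) (zacc (block Q x y) j.+1) * 2 ^ (blen j - blen j %/ d).
Proof.
move=> d0 id /andP[lo hi] small Hk.
pose w j := W U s k (n - j ^ 3) (zacc (block Q x y) j).
pose e j := blen j - blen j %/ d.
have [/existsP [[j ji] /= /andP[j0j lt]]|none] :=
  boolP [exists j : 'I_i, (i %/ d <= j) && (w j < w j.+1 * 2 ^ e j)].
  by exists j => //; rewrite j0j.
exfalso; have j0i : i %/ d <= i by apply: leq_div.
have tel := @telescope w e (i %/ d) i j0i.
have {}tel : w i * 2 ^ (\sum_(i %/ d <= j < i) e j) <= w (i %/ d).
  apply: tel => j /andP[lj ji]; rewrite leqNgt; apply/negP => lt.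
  by case/negP: none; apply/existsP; exists (Ordinal ji); rewrite /= lj lt.
(* A program that prints the first [n] bits of [z] is counted for their prefix of [i] blocks. *)
have wi : 0 < w i.
  case/bsum_gt0P: Hk => p plt /eqP E; apply/bsum_gt0P; exists p => //.
  by rewrite E beta_prefix_div // beta_zseq.
have w0 : w (i %/ d) <= 2 ^ k.+1 by apply: W_le.
have sum_le : \sum_(i %/ d <= j < i) e j <= k.+1.
  rewrite -(@leq_exp2l 2) //; apply: leq_trans w0; apply: leq_trans tel.
  by rewrite leq_pmull.
have lower : d.-1 * (i ^ 3 - (i %/ d) ^ 3) <= d * k.+1.
  apply: leq_trans (_ : d * \sum_(i %/ d <= j < i) e j <= _); last by rewrite leq_mul2l sum_le orbT.
  rewrite -(sum_blen j0i) !big_distrr /=; apply: leq_sum => j _; rewrite /e.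
  have := leq_trunc_div (blen j) d; have := leq_div (blen j) d.
  move: (blen j) (blen j %/ d) => m q; clear; case: d => // d; rewrite mulnBr; lia.
have j0d : d * (i %/ d) ^ 3 <= i ^ 3.
  apply: (@leq_trans ((i %/ d * d) ^ 3)); last by rewrite leq_exp2r // leq_trunc_div.
  by rewrite expnMn mulnC leq_mul // -{1}(expn1 d) leq_pexp2l.
have i3 : 7 * d * (i * i) <= i ^ 3.
  by rewrite (_ : i ^ 3 = i * (i * i)) ?leq_mul2r ?id ?orbT // !expnS; lia.
have j0le : (i %/ d) ^ 3 <= i ^ 3 by rewrite leq_exp2r.
by rewrite cubeS in hi; apply: (cube_gap d0 id i3 j0le j0d lo hi small lower).
Qed.

End Rate.

Section Rate.
Variables (U : code) (HU : universal U) (Q : nat) (x y : bitstream).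
Hypothesis Q0 : 0 < Q.
Let Kx t := Kc U (prefix x t).
Let Ky t := Kc U (prefix y t).
Variables (N0 c1 : nat).
Hypothesis rx : forall n, N0 <= n -> n <= Q * Kx n.
Hypothesis ry : forall n, N0 <= n -> n <= Q * Ky n.
Hypothesis ind : forall j, Kx (tlen Q j) + Ky (tlen Q j) <=
  Kc U (prefix x (tlen Q j) ++ prefix y (tlen Q j)) + c1 * (1 + 2 * (Q.+1 * j)).

(** As [tlen Q j.+1 >= 2 * Q * tlen Q j], the complexity is at least [2 * tlen Q j], which absorbs
    the rounding terms of [cand_count] and the block length. *)
Lemma rate_half (u : bitstream) j : 9 <= j -> N0 <= j ->
  (forall n, N0 <= n -> n <= Q * Kc U (prefix u n)) ->
  2 ^ (tlen Q j).+1 * Kcol Q j <= 2 ^ Kc U (prefix u (tlen Q j.+1)) /\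
  blen j <= Kc U (prefix u (tlen Q j.+1)).
Proof.
move=> j9 jN ru.
have jt : j.+1 <= tlen Q j.+1.
  by apply: leq_trans (ltnW (ltn_expl j.+1 (isT : 1 < 2))) _; rewrite leq_exp2l // leq_pmull.
have := ru (tlen Q j.+1) (leq_trans jN (ltnW jt)); set a := Kc U _ => ra.
have ts : tlen Q j.+1 = 2 * 2 ^ Q * tlen Q j by rewrite /tlen mulnS expnD expnS.
have Qe : Q <= 2 ^ Q by apply/ltnW/ltn_expl.
have a2 : 2 * tlen Q j <= a.
  rewrite -(@leq_pmul2l Q) // (leq_trans _ ra) // ts mulnCA mulnA leq_mul2r.
  by rewrite leq_mul2l Qe !orbT.
have v9 : 9 <= Q.+1 * j by apply: leq_trans j9 _; rewrite leq_pmull.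
have := quad_le_exp v9; rewrite -/(tlen Q j) => tj.
have jv : j <= Q.+1 * j by rewrite leq_pmull.
have bj : blen j + Q.+1 * j.+1 + 3 <= tlen Q j.
  rewrite blen_quad; apply: leq_trans tj.
  have : j * j <= (Q.+1 * j) * (Q.+1 * j) by rewrite leq_mul.
  have : Q.+1 <= Q.+1 * j by rewrite leq_pmulr //; lia.
  rewrite mulnS; lia.
split; last by lia.
rewrite /Kcol /tlen -[4]/(2 ^ 2) -!expnD leq_exp2l // -/(tlen Q j); lia.
Qed.

(** This is the rate [1 - 4 / d] with denominators cleared. *)
Lemma zseq_rate d : 0 < d -> exists N, forall n, N <= n ->
  n * d <= Kc U (prefix (zseq Q x y) n) * d + 4 * n.
Proof.
move=> d0; have [c0 Hc0] := Kc_le_size HU; have [c2 Hc2] := pair_upper HU Q.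
(* [l j] bits suffice for every parameter: [n] is less than [(d * j.+1) ^ 3], and the complexities
   are at most [tlen Q j.+1 + c0]. *)
pose l j := Q.+1 * j.+1 + c0 + 3 * (d + j) + 5.
(* [B * j] will bound all logarithmic terms, including the loss in the independence inequality. *)
pose B := 8 + 8 * (Q.+1 + c0 + 3 * d + 5) + c2 + c1 * (1 + 2 * Q.+1) +
  (8 * (Q.+1 + 3) + c1 * (2 * Q.+1)).
have lB j : 0 < j -> 8 + 8 * l j + c2 + c1 * (1 + 2 * (Q.+1 * j.+1)) <= B * j.
  rewrite /l /B mulnS => j0.
  set C1 := 8 + 8 * (Q.+1 + c0 + 3 * d + 5) + c2 + c1 * (1 + 2 * Q.+1).
  have : C1 <= C1 * j by rewrite leq_pmulr.
  by rewrite /C1; lia.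
(* From [J] on, [rate_half] applies, and the gain [blen j %/ d] exceeds [B * j] because [blen j] is
   quadratic. *)
pose J := maxn (maxn 9 N0) (d * B.+1).
exists ((d * J + 7 * d) ^ 3) => n nN; rewrite leqNgt; apply/negP => small.
set z := zseq Q x y in small *; set k := Kc U _ in small.
have [i /andP[lo hi]] := cube_floor n.
have iN : d * J + 7 * d <= i.
  by rewrite -ltnS -(@ltn_exp2r _ _ 3) //; apply: leq_ltn_trans nN hi.
have [s [Hz Hs]] := @common_stage U HU Q x y n i.
have [|j /andP[j0j ji] lt] := light_block d0 _ (introT andP (conj lo hi)) small Hz; first lia.
have jJ : J <= j by apply: leq_trans j0j; rewrite leq_divRL // mulnC; lia.
have idj : i < d * j.+1.
  by rewrite mulnC; apply: (leq_trans (ltn_ceil i d0)); rewrite leq_mul2r ltnS j0j orbT.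
have j9 : 9 <= j by apply: leq_trans jJ; rewrite !leq_max.
have jN : N0 <= j by apply: leq_trans jJ; rewrite !leq_max leqnn orbT.
have jB : d * B.+1 <= j by apply: leq_trans jJ; rewrite !leq_max leqnn orbT.
have [Kax mx] := rate_half j9 jN rx; have [Kay my] := rate_half j9 jN ry.
have [sx sy] := Hs _ ji.
set t := tlen Q j.+1 in Kax Kay mx my sx sy *.
move: lt; set w := W U s k (n - j.+1 ^ 3) _ => lt.
have w0 : 0 < w by case: (w) lt.
(* The thresholds are powers of two; rounding [w] down costs the extra 1 in [th']. *)
pose th := trunc_log 2 w; have /andP[th1 th2] : 2 ^ th <= w < 2 ^ th.+1 by apply: trunc_log_bounds.
pose th' := th.+1 + (blen j - blen j %/ d).
have wk : w <= 2 ^ k.+1 by apply: W_le.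
have thk : th <= k.+1 by rewrite -(@leq_exp2l 2) //; apply: leq_trans wk.
have kn : k < n.
  by rewrite -(@ltn_pmul2r d) //; apply: leq_ltn_trans small; apply: leq_addr.
have ji3 : j.+1 ^ 3 <= n by apply: leq_trans lo; rewrite leq_exp2r.
have bn : blen j <= n by apply: leq_trans ji3; rewrite blenE leq_addl.
have ax : Kx t <= t + c0 by rewrite -[t in t + _](size_mkseq x); apply: Hc0.
have ay : Ky t <= t + c0 by rewrite -[t in t + _](size_mkseq y); apply: Hc0.
have big1 : n + n + 2 < 2 ^ l j.
  have : i.+1 <= 2 ^ (d + j.+1).
    apply: leq_trans idj _; rewrite expnD leq_mul //; apply/ltnW/ltn_expl => //.
  rewrite -(@leq_exp2r _ _ 3) // -expnM => h.
  have := leq_trans hi h => {h} h.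
  apply: (@leq_ltn_trans (2 ^ ((d + j.+1) * 3).+1)); first last.
    by rewrite ltn_exp2l // /l; clear; lia.
  by rewrite expnS; move: h; set Z := 2 ^ _; clear; lia.
have big2 : t + c0 < 2 ^ l j.
  apply: (@leq_ltn_trans (2 ^ (Q.+1 * j.+1 + c0))); last by rewrite ltn_exp2l // /l; clear; lia.
  rewrite expnD -/t; have : 0 < t by rewrite expn_gt0.
  move=> t0; apply: (@leq_trans (t * c0.+1)); last by rewrite leq_mul // ltn_expl.
  by rewrite mulnS leq_add2l leq_pmull.
have jl : j < n by apply: leq_trans ji3; rewrite -{1}(expn1 j.+1) leq_pexp2l.
have := @Hc2 (l j) j n k th th' (Kx t) (Ky t) s x y _ _ ji3 Kax Kay _; rewrite -/t.
have -> : th' + Kx t + Ky t + 7 - blen j - th = Kx t + Ky t + 8 - blen j %/ d.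
  have := leq_div (blen j) d; rewrite /th'; move: mx; rewrite -/(Kx t).
  by move: (blen j) (blen j %/ d) (Kx t) (Ky t) (th); clear; lia.
move=> H; have := H _ _ _; clear H => H.
have up : Kc U (prefix x t ++ prefix y t) <= Kx t + Ky t + 8 - blen j %/ d + 8 * l j + c2.
  apply: H.
  - by move: big1 jl kn thk; move: (2 ^ l j) => L; clear; split; lia.
  - rewrite /th'; move: big1 big2 jl kn thk bn ax ay.
    by move: (blen j) (blen j %/ d) (Kx t) (Ky t) (2 ^ l j) => m e a b L; clear; split; lia.
  rewrite /cand -/t !zb_prefix // sx sy th1 /=.
  have hl u : has_len t (beta (prefix u t)).
    by have := beta_bounds (prefix u t); rewrite size_mkseq.
  rewrite !hl /=; apply: leq_trans (ltnW lt) _.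
  by rewrite /th' expnD leq_mul2r ltnW ?orbT.
have := ind j.+1; rewrite -/t => id.
have e_big : B * j < blen j %/ d.
  rewrite leq_divRL // blen_quad.
  apply: (@leq_trans (j * j)); last by clear; lia.
  apply: (@leq_trans (d * B.+1 * j)); last by rewrite leq_mul2r jB orbT.
  rewrite mulnC -mulnA leq_mul2l; apply/orP; right; rewrite mulSn -add1n leq_add2r.
  exact: leq_trans j9.
have := lB j (leq_trans (isT : 0 < 9) j9); have := leq_div (blen j) d.
move: mx my up id e_big; rewrite -/(Kx t) -/(Ky t).
move: (Kx t) (Ky t) (blen j) (blen j %/ d) (B * j) (8 * l j) (Kc U _) (c1 * _).
by move=> a b m e X L xy C; clear; lia.
Qed.
End Rate.

(* Imported only here: [Reals] rebinds [^] in [nat_scope] to [Nat.pow]. *)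
From mathcomp Require Import Rstruct.
From Stdlib Require Import Reals.
Import Order.TTheory GRing.Theory Num.Theory.
Local Open Scope ring_scope.

(** The code is at least the denominator, and a positive rational is at least the inverse of its
    denominator. *)
Lemma code_rat_bound (tau : rat) : 0 < tau ->
  (0 < code_rat tau)%nat /\ 1 <= ratr tau * (code_rat tau)%:R :> R.
Proof.
move=> t0; have den : (`|denq tau|%nat <= code_rat tau)%nat.
  by rewrite /code_rat /npair leq_addl.
have d0 : (0 < `|denq tau|)%nat by rewrite absz_gt0 denq_neq0.
split; first exact: leq_trans d0 den.
have tq : 1 <= tau * (`|denq tau|%nat)%:R.
  rewrite -[X in _ <= X * _]divq_num_den natr_absz ger0_norm ?denq_ge0 //.
  rewrite mulfVK ?intr_eq0 ?denq_neq0 // -[1]/(1%:~R) ler_int.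
  by rewrite -gtz0_ge1 numq_gt0.
have tR : 0 <= ratr tau :> R by rewrite ler0q ltW.
apply: le_trans (_ : ratr tau * (`|denq tau|%nat)%:R <= _); last first.
  by rewrite ler_wpM2l // ler_nat.
by rewrite -(ratr_nat R) -rmorphM -(rmorph1 (@ratr R)) ler_rat.
Qed.

Lemma has_rate_nat U tau u : 0 < tau -> has_rate U (ratr tau : R) u ->
  exists N, forall n, (N <= n)%nat -> (n <= code_rat tau * Kc U (prefix u n))%nat.
Proof.
move=> t0 [N HN]; exists N => n /HN /RleP; rewrite !INRE !RealsE => h.
have [_ tQ] := code_rat_bound t0; rewrite -(ler_nat R) natrM.
have n0 : 0 <= n%:R :> R by apply: ler0n.
apply: le_trans (_ : (ratr tau * (code_rat tau)%:R) * n%:R <= _).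
  by rewrite -[X in X <= _]mul1r ler_wpM2r.
by rewrite mulrAC mulrC ler_wpM2l // ler0n.
Qed.

Lemma log2_pow v : log2 (INR (expn 2 v)) = INR v.
Proof.
have -> : INR (expn 2 v) = pow 2 v by rewrite INRE natrX RpowE.
have l2 : ln 2 <> R0 by apply/Rgt_not_eq/(Rlt_trans _ _ _ (Rinv_0_lt_compat _ Rlt_0_2) ln_lt_2).
rewrite /log2 ln_pow; last by apply: Rlt_0_2.
by rewrite /Rdiv Rmult_assoc Rinv_r // Rmult_1_r.
Qed.

(** Both prefixes are taken of length [tlen Q j], whose logarithm is exactly [Q.+1 * j]. *)
Lemma independent_nat U Q x y : independent U x y -> exists c, forall j,
  (Kc U (prefix x (tlen Q j)) + Kc U (prefix y (tlen Q j)) <=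
   Kc U (prefix x (tlen Q j) ++ prefix y (tlen Q j)) + c * (1 + 2 * (Q.+1 * j)))%nat.
Proof.
case=> c Hc; exists (Num.bound `|c|) => j.
have t0 : (0 < tlen Q j)%nat by rewrite expn_gt0.
have L : log2 (INR (tlen Q j)) = INR (Q.+1 * j)%nat by apply: log2_pow.
have /Rge_le /RleP := Hc _ _ t0 t0; rewrite L !INRE !RealsE.
set a := Kc U _; set b := Kc U _; set e := Kc U _; set v := (Q.+1 * j)%nat.
clearbody a b e v => h.
rewrite mul2n -addnn -(ler_nat R) !natrD natrM !natrD.
have v0 : 0 <= 1 + v%:R + v%:R :> R by rewrite !addr_ge0 ?ler0n ?ler01.
have cb : c <= (Num.bound `|c|)%:R.
  by apply: le_trans (ler_norm _) (ltW (archi_boundP _)); apply: normr_ge0.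
by have := ler_wpM2r v0 cb; lra.
Qed.

Theorem theorem1p1 (U : code) (HU : universal U) :
  exists Mf : code,
    (forall (tau : rat), 0 < tau -> tau <= 1 ->
     forall x y : bitstream,
       independent U x y -> has_rate U (ratr tau : R) x -> has_rate U (ratr tau : R) y ->
       exists z : bitstream, transforms Mf tau x y z /\
         forall delta : R, Rlt R0 delta -> has_rate U (Rminus R1 delta) z)
    /\ truth_table Mf.
Proof.
have [Mf HMf] := zseq_code.
exists Mf; split; last by move=> x y tau n; eexists; apply: HMf.
move=> tau t0 _ x y ind rx ry; have [Q0 _] := code_rat_bound t0.
exists (zseq (code_rat tau) x y); split=> [n|delta /RltP d0]; first exact: HMf.
have [c Hc] := independent_nat (code_rat tau) ind.
have [Nx Hx] := has_rate_nat t0 rx; have [Ny Hy] := has_rate_nat t0 ry.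
(* This makes [4 / d <= delta]. *)
pose d := (Num.bound (4 / delta)).+1.
have Hx' n : (maxn Nx Ny <= n)%nat -> _ := fun h => Hx n (leq_trans (leq_maxl _ _) h).
have Hy' n : (maxn Nx Ny <= n)%nat -> _ := fun h => Hy n (leq_trans (leq_maxr _ _) h).
have [//|N HN] := zseq_rate HU Q0 Hx' Hy' Hc (d := d).
exists N => n /HN; rewrite -(ler_nat R) natrD !natrM => h.
apply/RleP; rewrite !INRE !RealsE.
have dd : 4 <= delta * d%:R.
  rewrite mulrC -ler_pdivrMr // ltW //; apply: lt_le_trans (archi_boundP _) _.
    by rewrite divr_ge0 // ltW.
  by rewrite ler_nat.
have dp : 0 < d%:R :> R by rewrite ltr0n.
rewrite -(ler_pM2r dp) mulrBl mul1r mulrBl.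
have := ler_wpM2r (ler0n R n) dd; rewrite mulrAC.
move: h; lra.
Qed.
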